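(* Let $K$ be a field, let $\sigma,\tau\in\mathrm{Aut}(K)$, and let $M$ be a twisted Gelfand-Ponomarev module over $K[F,V]_{\sigma,\tau}$. There exist (i) a Kraft quiver $\Gamma$ whose connected components are pairwise non-isomorphic, and all of whose circular connected components have no repetitions, and (ii) a strict $(\sigma,\tau)$-linear representation $(U,\rho)$ on $\Gamma$, such that $M\simeq M(\Gamma,U,\rho)$ as $K[F,V]_{\sigma,\tau}$-modules. If $\Gamma'$ and $(U',\rho')$ are another Kraft quiver and strict $(\sigma,\tau)$-linear representation meeting the same conditions (including $M\simeq M(\Gamma',U',\rho')$), then there exists an isomorphism $\Gamma\simeq\Gamma'$ making $(U,\rho)$ isomorphic to $(U',\rho')$.
   Context: Twisted modules. $K[F,V]_{\sigma,\tau}$ is the $K$-algebra generated by $F,V$ subject to $FV=VF=0$, $F\lambda=\sigma(\lambda)F$, $V\lambda=\tau(\lambda)V$ for $\lambda\in K$. A twisted Gelfand-Ponomarev module is a left $K[F,V]_{\sigma,\tau}$-module of finite dimension over $K$, i.e. a finite dimensional $K$-vector space with a $\sigma$-linear operator $F$ and a $\tau$-linear operator $V$ such that $FV=VF=0$. Graphs. A finite directed graph labeled by an alphabet $\mathcal A$ is a triple $(\mathcal V,\mathcal E,\mathrm{label})$ where $\mathcal V$ is a finite set (vertices), $\mathcal E$ is a subset of $\mathcal V\times\mathcal V$ (arrows), and $\mathrm{label}:\mathcal E\to\mathcal A$ is a function; the arrow $(v_1,v_2)$ has tail $v_1$ and head $v_2$, and loops $(v,v)$ are allowed. An arrow with label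 $F$ (resp. $V$) is called an $F$-arrow (resp. $V$-arrow). An isomorphism of such graphs is a bijection on vertices inducing a label-preserving bijection on arrows. Connectedness and connected components refer to the underlying undirected graph. A Kraft quiver is a finite directed graph labeled by $\{F,V\}$ such that: (1) each vertex is the tail or the head of at most $2$ arrows; (2) two distinct arrows with the same label have distinct heads and distinct tails; (3) the head of any $F$-arrow is not the tail of any $V$-arrow, and the tail of any $F$-arrow is not the head of any $V$-arrow. The converse graph $\Gamma^{\#}$ of $\Gamma$ is the directed graph labeled by $\{F,V^{\#}\}$ obtained from $\Gamma$ by reversing all $V$-arrows and relabeling them $V^{\#}$ ($F$-arrows are unchanged); $\mathcal E^{\#}$ is its set of arrows and $\mathrm{label}^{\#}$ its label function. A Kraft quiver with $n$ vertices is connected circular if its vertices can be ordered $v_1,\dots,v_n$ so that $\mathcal E^{\#}=\{(v_i,v_{i+1}):1\le i\le n\}$, where $v_{n+1}:=v_1$ (indices are then taken in $\mathbb Z/n\mathbb Z$). A non-empty connected circular Kraft quiver, with $E_i:=(v_i,v_{i+1})\in\mathcal E^{\#}$, has repetitions if there is an integer $1\le m<n$ dividing $n$ with $\mathrm{label}^{\#}(E_i)=\mathrm{label}^{\#}(E_{m+i})$ for all $i\in\mathbb Z/n\mathbb Z$; otherwise it has no repetitions. Representations. A $(\sigma,\tau)$-linear representation $(U,\rho)$ of $\Gamma$ over $K$ is a family of finite dimensional $K$-vector spaces $U_v$ ($v\in\mathcal V$) and homomorphisms $\rho_E:U_{v_1}\to U_{v_2}$ for each arrow $E=(v_1,v_2)$,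 where $\rho_E$ is $\sigma$-linear if $E$ is an $F$-arrow and $\tau$-linear if $E$ is a $V$-arrow. It is strict if every $\rho_E$ is an isomorphism. An isomorphism of representations is a family of $K$-linear isomorphisms $U_v\to U'_v$ commuting with the maps $\rho_E,\rho'_E$. The module attached to $(U,\rho)$ is $M(\Gamma,U,\rho)=\bigoplus_{v\in\mathcal V}U_v$, where $F$ restricted to $U_v$ is the direct sum of the $\rho_E$ over the $F$-arrows $E$ with tail $v$ (zero if there are none), and $V$ restricted to $U_v$ is the direct sum of the $\rho_E$ over the $V$-arrows $E$ with tail $v$ (zero if there are none). For a Kraft quiver this is a twisted Gelfand-Ponomarev module.
   Formalization: An F-arrow and a V-arrow may share both tail and head (else existence fails for K^2 with F e1 = V e1 = e2, F e2 = V e2 = 0), and every U_v is required to be nonzero in both parts (else uniqueness fails, since components carrying zero spaces could be added). *)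

(* Defs.v *)
From HB Require Import structures.
From mathcomp Require Import all_boot all_order all_algebra.

Set Implicit Arguments.
Unset Strict Implicit.
Unset Printing Implicit Defensive.

Import GRing.Theory VectorInternalTheory.
Local Open Scope ring_scope.

(* An arrow is a triple (tail, head, label), so that two arrows with different
   labels may share both tail and head. This is needed: F e1 = V e1 = e2 on K^2
   must come from the circular quiver with an F-arrow and a V-arrow both from
   v1 to v2. *)
Record lgraph (A : finType) := LGraph {
  vertex :> finType;
  arrows : {set vertex * vertex * A}
}.

Section Graphs.
Variable A : finType.
Implicit Types G H : lgraph A.

Definition tail G (e : G * G * A) : G := e.1.1.
Definition head G (e : G * G * A) : G := e.1.2.
Definition label G (e : G * G * A) : A := e.2.

Definition graph_iso G H (f : G -> H) : Prop :=
  bijective f /\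
  forall u v l, ((f u, f v, l) \in arrows H) = ((u, v, l) \in arrows G).

Definition graph_isomorphic G H : Prop := exists f : G -> H, graph_iso f.

Definition adjacent G : rel G := fun u v =>
  [exists l, ((u, v, l) \in arrows G) || ((v, u, l) \in arrows G)].

Definition components G : {set {set G}} :=
  [set [set w | connect (@adjacent G) v w] | v : G].

Definition induced G (C : {set G}) : lgraph A :=
  LGraph [set e : {v | v \in C} * {v | v \in C} * A |
            (val e.1.1, val e.1.2, e.2) \in arrows G].

End Graphs.

Variant letter := LF | LV.

Definition letter_bool l := if l is LF then true else false.
Definition bool_letter b := if b then LF else LV.
Fact letter_boolK : cancel letter_bool bool_letter. Proof. by case. Qed.
HB.instance Definition _ := Finite.copy letter (can_type letter_boolK).

(* The alphabet {F, V^#} of converse graphs. *)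
Variant sharp_letter := SF | SVsharp.

Definition sharp_bool l := if l is SF then true else false.
Definition bool_sharp b := if b then SF else SVsharp.
Fact sharp_boolK : cancel sharp_bool bool_sharp. Proof. by case. Qed.
HB.instance Definition _ := Finite.copy sharp_letter (can_type sharp_boolK).

Definition quiver := lgraph letter.

Definition kraft (G : quiver) : Prop :=
  [/\ forall v : G, #|[set e in arrows G | (tail e == v) || (head e == v)]| <= 2,
      {in arrows G &, forall e e', e != e' -> label e = label e' ->
         head e != head e' /\ tail e != tail e'}
    & {in arrows G &, forall e e', label e = LF -> label e' = LV ->
         head e != tail e' /\ tail e != head e'}]%N.

Definition converse (G : quiver) : lgraph sharp_letter :=
  LGraph [set e : G * G * sharp_letter |
            match e.2 with
            | SF => (e.1.1, e.1.2, LF) \in arrows G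
            | SVsharp => (e.1.2, e.1.1, LV) \in arrows G
            end].

(* v enumerates the vertices so that the arrows of the converse graph are
   exactly the E_i = (v_i, v_{i+1}), with label lab i; ordS is the cyclic
   successor on 'I_n, so indices are taken modulo n. *)
Definition circular_order (G : quiver) n (v : 'I_n -> G)
    (lab : 'I_n -> sharp_letter) : Prop :=
  bijective v /\
  arrows (converse G) = [set (v i, v (ordS i), lab i) | i : 'I_n].

Definition circular (G : quiver) : Prop :=
  exists n (v : 'I_n -> G) lab, circular_order v lab.

(* The period condition does not depend on the chosen circular order: two of
   them differ by a rotation. *)
Definition has_repetitions (G : quiver) : Prop :=
  exists n (v : 'I_n -> G) lab, circular_order v lab /\
  exists m, [/\ 1 <= m < n, m %| n &
    forall i, lab i = lab (iter m (@ordS n) i)]%N.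

Definition components_non_isomorphic (G : quiver) : Prop :=
  {in components G &, forall C D, C != D ->
     ~ graph_isomorphic (induced C) (induced D)}.

Definition circular_components_no_repetitions (G : quiver) : Prop :=
  {in components G, forall C, circular (induced C) ->
     ~ has_repetitions (induced C)}.

(* Finite direct sums of finite-dimensional vector spaces. *)
Section DirectSum.
Variables (K : fieldType) (I : finType) (U : I -> vectType K).

Definition dirsum := {dffun forall i, U i}.
HB.instance Definition _ := Choice.on dirsum.

Implicit Types x y z : dirsum.

Definition dirsum_add x y : dirsum := [ffun i => x i + y i].
Definition dirsum_opp x : dirsum := [ffun i => - x i].
Definition dirsum_zero : dirsum := [ffun i => 0].
Definition dirsum_scale (a : K) x : dirsum := [ffun i => a *: x i].

Fact dirsum_addA : associative dirsum_add.
Proof. by move=> x y z; apply/ffunP=> i; rewrite !ffunE addrA. Qed.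
Fact dirsum_addC : commutative dirsum_add.
Proof. by move=> x y; apply/ffunP=> i; rewrite !ffunE addrC. Qed.
Fact dirsum_add0 : left_id dirsum_zero dirsum_add.
Proof. by move=> x; apply/ffunP=> i; rewrite !ffunE add0r. Qed.
Fact dirsum_addN : left_inverse dirsum_zero dirsum_opp dirsum_add.
Proof. by move=> x; apply/ffunP=> i; rewrite !ffunE addNr. Qed.

HB.instance Definition _ := GRing.isZmodule.Build dirsum
  dirsum_addA dirsum_addC dirsum_add0 dirsum_addN.

Lemma dirsumDE x y i : (x + y) i = x i + y i.
Proof. by rewrite ffunE. Qed.

Lemma dirsum0E i : (0 : dirsum) i = 0.
Proof. by rewrite ffunE. Qed.

Fact dirsum_scaleA a b x :
  dirsum_scale a (dirsum_scale b x) = dirsum_scale (a * b) x.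
Proof. by apply/ffunP=> i; rewrite !ffunE scalerA. Qed.
Fact dirsum_scale1 : left_id 1 dirsum_scale.
Proof. by move=> x; apply/ffunP=> i; rewrite !ffunE scale1r. Qed.
Fact dirsum_scaleDr : right_distributive dirsum_scale +%R.
Proof. by move=> a x y; apply/ffunP=> i; rewrite !ffunE scalerDr. Qed.
Fact dirsum_scaleDl x :
  {morph dirsum_scale^~ x : a b / a + b}.
Proof. by move=> a b; apply/ffunP=> i; rewrite !ffunE scalerDl. Qed.

HB.instance Definition _ := GRing.Zmodule_isLmodule.Build K dirsum
  dirsum_scaleA dirsum_scale1 dirsum_scaleDr dirsum_scaleDl.

Lemma dirsumZE a x i : (a *: x) i = a *: x i.
Proof. by rewrite ffunE. Qed.

Let d (j : 'I_#|I|) := dim (U (enum_val j)).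

Definition dirsum_v2r x : 'rV[K]_(\sum_j d j) :=
  \mxrow_j (v2r (x (enum_val j)) : 'rV_(d j)).

Fact dirsum_v2r_linear : linear dirsum_v2r.
Proof.
move=> a x y; apply/rowP => t; rewrite !mxE.
by rewrite dirsumDE dirsumZE linearD linearZ /= !mxE.
Qed.

Fact dirsum_v2r_inj : injective dirsum_v2r.
Proof.
move=> x y exy; apply/ffunP=> i; rewrite -(enum_rankK i).
have /(congr1 (fun A => submxrow A (enum_rank i))) := exy.
by rewrite !mxrowK; apply: (can_inj (@v2rK _ _)).
Qed.

Fact dirsum_v2r_surj w : exists x, dirsum_v2r x == w.
Proof.
pose g (j : 'I_#|I|) : U (enum_val j) := @r2v _ (U (enum_val j)) (submxrow w j).
exists [ffun i => eq_rect _ U (g (enum_rank i)) _ (enum_rankK i)].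
apply/eqP; rewrite -[RHS]submxrowK; apply/eq_mxrow => j.
rewrite ffunE; set x := eq_rect _ _ _ _ _.
suff ->: x = g j by rewrite r2vK.
rewrite {}/x; move: (enum_rank _) (enum_rankK _) => k e.
have ekj := enum_val_inj e; case: j / ekj e => e.
by rewrite (eq_axiomK e).
Qed.

Fact dirsum_v2r_bij : bijective dirsum_v2r.
Proof.
exists (fun w => xchoose (dirsum_v2r_surj w)) => [x|w].
  by apply: dirsum_v2r_inj; apply/eqP; apply: (xchooseP (dirsum_v2r_surj _)).
by apply/eqP; apply: (xchooseP (dirsum_v2r_surj _)).
Qed.

Fact dirsum_vect_axiom : Vector.axiom (\sum_j d j)%N dirsum.
Proof. exact: (exist2 _ _ dirsum_v2r dirsum_v2r_linear dirsum_v2r_bij). Qed.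

HB.instance Definition _ := Lmodule_hasFinDim.Build K dirsum dirsum_vect_axiom.

End DirectSum.

Section TwistedModules.
Variables (K : fieldType) (sigma tau : {rmorphism K -> K}).

(* {linear U -> W | nu \; *:%R} is the type of nu-linear maps: additive maps f
   with f (a *: x) = nu a *: f x. *)
Record twisted_space := TwistedSpace {
  carrier :> vectType K;
  opF : {linear carrier -> carrier | sigma \; *:%R};
  opV : {linear carrier -> carrier | tau \; *:%R}
}.

Definition gelfand_ponomarev (M : twisted_space) : Prop :=
  forall x : M, opF M (opV M x) = 0 /\ opV M (opF M x) = 0.

Definition module_isomorphic (M N : twisted_space) : Prop :=
  exists f : {linear M -> N}, [/\ bijective f,
    forall x, f (opF M x) = opF N (f x) & forall x, f (opV M x) = opV N (f x)].

Definition twist (l : letter) : {rmorphism K -> K} :=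
  match l with LF => sigma | LV => tau end.

(* repr_map is total for convenience: only the maps repr_map l u v with
   (u, v, l) an arrow are part of the representation, and nothing below depends
   on the others. *)
Record representation (G : quiver) := Representation {
  repr_space : G -> vectType K;
  repr_map : forall l u v,
    {linear repr_space u -> repr_space v | twist l \; *:%R}
}.

Section AttachedModule.
Variables (G : quiver) (R : representation G).

Definition strict : Prop :=
  forall u v l, (u, v, l) \in arrows G -> bijective (repr_map R l u v).

Definition nowhere_zero : Prop :=
  forall v, (0 < \dim {: repr_space R v})%N.

Definition attached_op l (x : dirsum (repr_space R)) : dirsum (repr_space R) :=
  [ffun v => \sum_(u | (u, v, l) \in arrows G) repr_map R l u v (x u)].

Fact attached_op_linear l : linear_for (twist l \; *:%R) (attached_op l).
Proof.
move=> a x y; apply/ffunP => v; rewrite dirsumDE dirsumZE !ffunE.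
rewrite scaler_sumr -big_split; apply: eq_bigr => u _ /=.
by rewrite dirsumDE dirsumZE linearP.
Qed.

HB.instance Definition _ l := GRing.isLinear.Build K _ _ _ _
  (attached_op_linear l).

Definition attached_map l :
    {linear dirsum (repr_space R) -> dirsum (repr_space R) | twist l \; *:%R} :=
  attached_op l.

Definition attached_module : twisted_space :=
  @TwistedSpace (dirsum (repr_space R)) (attached_map LF) (attached_map LV).

Lemma attached_module_gelfand_ponomarev :
  kraft G -> gelfand_ponomarev attached_module.
Proof.
case=> _ _ FV x; split; apply/ffunP => v; rewrite ffunE dirsum0E.
  apply: big1 => u uvF; rewrite ffunE big1 ?linear0 // => w wuV.
  by have [_ /eqP] := FV _ _ uvF wuV erefl erefl.
apply: big1 => u uvV; rewrite ffunE big1 ?linear0 // => w wuF.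
by have [/eqP] := FV _ _ wuF uvV erefl erefl.
Qed.

End AttachedModule.

Definition repr_isomorphic_along (G H : quiver) (f : G -> H)
    (R : representation G) (S : representation H) : Prop :=
  exists g : forall v, {linear repr_space R v -> repr_space S (f v)},
    (forall v, bijective (g v)) /\
    forall u v l, (u, v, l) \in arrows G ->
    forall x, g v (repr_map R l u v x) = repr_map S l (f u) (f v) (g u x).

(* Without nowhere_zero the decomposition could not be unique: a component
   carrying only zero spaces could be added to G at will. *)
Definition kraft_decomposition (M : twisted_space) (G : quiver)
    (R : representation G) : Prop :=
  [/\ kraft G, components_non_isomorphic G &
      circular_components_no_repetitions G] /\
  [/\ strict R, nowhere_zero R & module_isomorphic M (attached_module R)].

End TwistedModules.

(* Main.v *)
(* Since FV = VF = 0, the subspaces obtained from 0 and M by taking images under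
   F and preimages under V form a chain, and so do those obtained from images
   under V and preimages under F.  Two chains have a common splitting, so M is
   the sum of pieces indexed by pairs of steps.  F and V induce partial
   bijections between the pieces of the associated graded space, which makes it
   a strict representation of a Kraft quiver.  An arbitrary choice of lifts of
   the pieces to M satisfies F and V up to an error, one part of which can be
   pushed forwards along the quiver and the other pulled backwards until they
   die; so M is isomorphic to its graded space.

   Call two vertices of Kraft quivers of the same type if they occur in the same
   iterated images and preimages of the empty and of the full vertex set.  The
   conditions on components and repetitions say exactly that distinct vertices
   have distinct types, as is the case for the quiver above.  An isomorphism
   between attached modules is triangular with respect to types, whence its
   diagonal blocks are isomorphisms and give the uniqueness. *)
From HB Require Import structures.
From Stdlib Require Import Classical IndefiniteDescription.
From mathcomp Require Import all_boot all_order all_algebra.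
Require Import Defs.

Set Implicit Arguments.
Unset Strict Implicit.
Unset Printing Implicit Defensive.

Import GRing.Theory.

(** * Types of vertices of a Kraft quiver *)

Definition other l := if l is LF then LV else LF.

Lemma otherK : involutive other.
Proof. by case. Qed.

Section KraftArrows.
Variables (G : quiver) (kG : kraft G).

Lemma kraft_tail_eq u u' v l :
  (u, v, l) \in arrows G -> (u', v, l) \in arrows G -> u = u'.
Proof.
case: kG => _ k2 _ uv u'v; apply/eqP/negPn/negP => ne.
have ne' : (u, v, l) != (u', v, l) by apply: contraNneq ne => -[->].
by have [/eqP] := k2 _ _ uv u'v ne' erefl.
Qed.

Lemma kraft_head_eq u v v' l :
  (u, v, l) \in arrows G -> (u, v', l) \in arrows G -> v = v'.
Proof.
case: kG => _ k2 _ uv uv'; apply/eqP/negPn/negP => ne.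
have ne' : (u, v, l) != (u, v', l) by apply: contraNneq ne => -[->].
by have [_ /eqP] := k2 _ _ uv uv' ne' erefl.
Qed.

Lemma kraft_alternate u v w l :
  (u, v, l) \in arrows G -> (v, w, other l) \notin arrows G.
Proof.
case: kG => _ _ k3 uv; apply/negP => vw; case: l uv vw => uv vw.
  by have [/eqP] := k3 _ _ uv vw erefl erefl.
by have [_ /eqP] := k3 _ _ vw uv erefl erefl.
Qed.

End KraftArrows.

(* Condition (1) of the definition follows from (2) and (3): a vertex has at
   most one arrow of each label in each direction, and an F-arrow into it
   excludes a V-arrow out of it and vice versa. *)
Lemma kraftI (G : quiver) :
    (forall u u' v l,
       (u, v, l) \in arrows G -> (u', v, l) \in arrows G -> u = u') ->
    (forall u v v' l,
       (u, v, l) \in arrows G -> (u, v', l) \in arrows G -> v = v') ->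
    (forall u v w l,
       (u, v, l) \in arrows G -> (v, w, other l) \notin arrows G) ->
  kraft G.
Proof.
move=> tl hd alt; split.
- move=> v.
  have inout l : #|[set e in arrows G | ((head e == v) && (label e == l))
      || ((tail e == v) && (label e == other l))]| <= 1.
    apply/card_le1_eqP => -[[x y] a] [[x' y'] a'].
    rewrite !inE /tail /head /label /=.
    case/andP=> e1 /orP[]/andP[/eqP<- /eqP al];
      case/andP=> e2 /orP[]/andP[/eqP e /eqP al']; subst.
    - by rewrite (tl _ _ _ _ e1 e2).
    - by case/negP: (alt _ _ y' _ e1).
    - by case/negP: (alt _ _ y _ e2).
    - by rewrite (hd _ _ _ _ e1 e2).
  apply: leq_trans (leq_add (inout LF) (inout LV)).
  apply: leq_trans (leq_card_setU _ _); apply: subset_leq_card.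
  apply/subsetP => -[[x y] a]; rewrite !inE /tail /head /label /=.
  by case/andP=> -> /= /orP[]/eqP->; case: a; rewrite !eqxx ?orbT.
- move=> [[u v] l] [[u' v'] l'] /= uv u'v' ne ll'; rewrite /label /= in ll'.
  rewrite /head /tail /=; subst l'; split; apply: contraNneq ne => eq; subst.
    by rewrite (tl _ _ _ _ uv u'v').
  by rewrite (hd _ _ _ _ uv u'v').
- move=> [[u v] l] [[u' v'] l'] /= uv u'v'.
  rewrite /label /head /tail /= => ? ?; subst.
  split; apply/eqP => ?; subst.
    by case/negP: (alt _ _ v' _ uv).
  by case/negP: (alt _ _ v _ u'v').
Qed.

(* The vertices that carry the subspace obtained from 0 (if ~~ e) or from the
   whole module (if e) by taking successively, from right to left in w, images
   (true, l) and preimages (false, l) under the operator l. *)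
Fixpoint word_set (G : quiver) (e : bool) (w : seq (bool * letter)) (v : G) :=
  match w with
  | [::] => e
  | (true, l) :: w' =>
      [exists u, ((u, v, l) \in arrows G) && word_set e w' u]
  | (false, l) :: w' =>
      [forall u, ((v, u, l) \in arrows G) ==> word_set e w' u]
  end.

Definition same_type (G H : quiver) (v : G) (u : H) : Prop :=
  forall e w, word_set e w v = word_set e w u.

Definition separated (G : quiver) : Prop :=
  forall u v : G, same_type u v -> u = v.

Lemma same_type_sym (G H : quiver) (v : G) (u : H) :
  same_type v u -> same_type u v.
Proof. by move=> vu e w. Qed.

Lemma same_type_trans (G H I : quiver) (v : G) (u : H) (x : I) :
  same_type v u -> same_type u x -> same_type v x.
Proof. by move=> vu ux e w; rewrite vu. Qed.

Section WordSet.
Variables (G : quiver) (kG : kraft G) (u v : G) (l : letter).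
Hypothesis uv : (u, v, l) \in arrows G.

Lemma word_set_image e w : word_set e ((true, l) :: w) v = word_set e w u.
Proof.
apply/existsP/idP => [[u' /andP[u'v]]|hu]; last by exists u; rewrite uv.
by rewrite (kraft_tail_eq kG u'v uv).
Qed.

Lemma word_set_preimage e w : word_set e ((false, l) :: w) u = word_set e w v.
Proof.
apply/forallP/idP => [/(_ v)|hv v']; first by rewrite uv.
by apply/implyP => uv'; rewrite -(kraft_head_eq kG uv uv').
Qed.

End WordSet.

Section SameType.
Variables (G H : quiver) (kG : kraft G) (kH : kraft H).

(** The preimage of the empty set under [l] consists of the vertices without an [l]-arrow out, so
    types detect such arrows; prefixing [(false, l)] to words then compares the heads. *)
Lemma same_type_head (v v' : G) l (u : H) : same_type v u ->
  (v, v', l) \in arrows G ->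
  exists2 u', (u, u', l) \in arrows H & same_type v' u'.
Proof.
move=> vu vv'; have := vu false [:: (false, l)].
rewrite (word_set_preimage kG vv') => /esym/negbT.
rewrite negb_forall => /existsP[u']; rewrite negb_imply andbT => uu'.
exists u' => // e w.
by rewrite -(word_set_preimage kG vv') -(word_set_preimage kH uu').
Qed.

Lemma same_type_tail (v v' : G) l (u' : H) : same_type v' u' ->
  (v, v', l) \in arrows G ->
  exists2 u, (u, u', l) \in arrows H & same_type v u.
Proof.
move=> vu vv'; have := vu true [:: (true, l)].
rewrite (word_set_image kG vv') => /esym/existsP[u]; rewrite andbT => uu'.
exists u => // e w.
by rewrite -(word_set_image kG vv') -(word_set_image kH uu').
Qed.

End SameType.

(** * Components, rotations and types *)

Section Components.
Variables (A : finType) (G : lgraph A).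
Implicit Types C D : {set G}.

Lemma adjacent_arrow (u v : G) l : (u, v, l) \in arrows G -> adjacent u v.
Proof. by move=> uv; apply/existsP; exists l; rewrite uv. Qed.

Lemma adjacent_sym : symmetric (@adjacent A G).
Proof.
by move=> u v; apply/existsP/existsP => -[l uv]; exists l; rewrite orbC.
Qed.

Lemma connect_adjacent_sym : connect_sym (@adjacent A G).
Proof. exact/sym_connect_sym/adjacent_sym. Qed.

Lemma component_closed C : C \in components G -> closed (@adjacent A G) C.
Proof.
case/imsetP=> v _ ->; apply: (intro_closed connect_adjacent_sym) => x y xy.
by rewrite !inE => vx; apply: connect_trans vx (connect1 xy).
Qed.

Lemma component_arrow C u v l :
  C \in components G -> (u, v, l) \in arrows G -> (u \in C) = (v \in C).
Proof. by move=> hC /adjacent_arrow/(component_closed hC). Qed.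

Lemma component_connect C u v :
  C \in components G -> u \in C -> v \in C -> connect (@adjacent A G) u v.
Proof.
case/imsetP=> x _ ->; rewrite !inE => xu; apply: connect_trans.
by rewrite connect_adjacent_sym.
Qed.

Lemma component_of_eq C v : C \in components G -> v \in C ->
  C = [set w | connect (@adjacent A G) v w].
Proof.
move=> hC vC; apply/setP => w; rewrite inE; apply/idP/idP => [wC|vw].
  exact: component_connect wC.
by rewrite -(closed_connect (component_closed hC) vw).
Qed.

Lemma component_eq C D v : C \in components G -> D \in components G ->
  v \in C -> v \in D -> C = D.
Proof.
by move=> hC hD vC vD; rewrite (component_of_eq hC vC) (component_of_eq hD vD).
Qed.

End Components.

(** Word sets are computed along arrows, which never leave a component, so an isomorphism of
    components preserves them. *)
Lemma induced_iso_same_type (G : quiver) (C D : {set G})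
    (f : induced C -> induced D) : C \in components G -> D \in components G ->
  graph_iso f -> forall x, same_type (val x) (val (f x)).
Proof.
move=> hC hD [[g fK gK] fE] x e w.
have fE' (y z : induced C) l :
    ((val (f y), val (f z), l) \in arrows G) = ((val y, val z, l) \in arrows G).
  by have := fE y z l; rewrite !inE.
elim: w x => //= -[[] l] w IH x.
  apply/existsP/existsP => -[u /andP[ux hu]].
    have uC : u \in C by rewrite (component_arrow hC ux); apply: (valP x).
    by exists (val (f (Sub u uC))); rewrite fE' -IH ux.
  have uD : u \in D by rewrite (component_arrow hD ux); apply: (valP (f x)).
  exists (val (g (Sub u uD))).
  by rewrite IH -fE' gK ux.
apply/forallP/forallP => hx u; apply/implyP => xu.
  have uD : u \in D by rewrite -(component_arrow hD xu); apply: (valP (f x)).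
  have := hx (val (g (Sub u uD))).
  by rewrite IH -fE' gK xu.
have uC : u \in C by rewrite -(component_arrow hC xu); apply: (valP x).
by have := hx (val (f (Sub u uC))); rewrite fE' -IH xu.
Qed.

Lemma separated_components (G : quiver) :
  separated G -> components_non_isomorphic G.
Proof.
move=> sG C D hC hD neCD [f isof].
have [v _ eC] := imsetP hC.
have vC : v \in C by rewrite eC inE connect0.
have eqv := sG _ _ (induced_iso_same_type hC hD isof (Sub v vC)).
case/eqP: neCD; apply: (component_eq hC hD vC).
by have := valP (f (Sub v vC)); rewrite -eqv SubK.
Qed.

Lemma circular_arrow (G : quiver) n (v : 'I_n -> G) lab :
  circular_order v lab -> forall i j l,
  ((v i, v j, l) \in arrows (converse G)) = (j == ordS i) && (l == lab i).
Proof.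
case=> vbij -> i j l; apply/imsetP/andP => [[k _ [/(bij_inj vbij)<-]]|].
  by move=> /(bij_inj vbij)-> ->.
by case=> /eqP-> /eqP->; exists i.
Qed.

Lemma converse_arrow (G : quiver) u v l :
  ((u, v, l) \in arrows G) =
  if l is LF then (u, v, SF) \in arrows (converse G)
  else (v, u, SVsharp) \in arrows (converse G).
Proof. by case: l; rewrite !inE. Qed.

Lemma val_iter_ordS n m (i : 'I_n) : val (iter m (@ordS n) i) = (i + m) %% n.
Proof.
elim: m => [|m IH] /=; first by rewrite addn0 modn_small.
by rewrite IH -addn1 modnDml addn1 addnS.
Qed.

(** For a period [m] of the labels, rotation by [m] is an automorphism of the component. It
    preserves types, so separation makes it the identity, against [0 < m < n]. *)
Lemma separated_circular (G : quiver) :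
  separated G -> circular_components_no_repetitions G.
Proof.
move=> sG C hC _ [n [v [lab [co [m [/andP[m0 mn] _ per]]]]]].
have [vbij _] := co; have [w vK wK] := vbij.
pose r i := iter m (@ordS n) i.
have rinj : injective r 
  by rewrite /r => i j; elim: (m) => //= k IH /ordS_inj/IH.
have rS i : r (ordS i) = ordS (r i) by rewrite /r -iterSr.
have isof : graph_iso (v \o r \o w).
  split.
    apply: bij_comp; last by exists v.
    by apply: bij_comp => //; apply: injF_bij.
  move=> x y l; have rot i j : ((v (r i), v (r j), l) \in arrows (induced C))
      = ((v i, v j, l) \in arrows (induced C)).
    rewrite 2!converse_arrow.
    by case: l; rewrite !(circular_arrow co) -rS (inj_eq rinj) /r -per.
  by have := rot (w x) (w y); rewrite !wK.
have n0 : 0 < n by apply: leq_ltn_trans mn.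
have := induced_iso_same_type hC hC isof (v (Ordinal n0)) => /sG/val_inj/=.
rewrite vK => /(bij_inj vbij)/(congr1 val).
by rewrite val_iter_ordS /= add0n modn_small // => m0'; rewrite -m0' in m0.
Qed.

(** * Paths and cycles of the converse graph *)

Section Converse.
Variables (G : quiver) (kG : kraft G).
Implicit Types (x y u v : G) (l : sharp_letter).

Notation carrows := (arrows (converse G)).

(** Reversing the V-arrows turns conditions (2) and (3) into one rule: at most one arrow out of each
    vertex and, by the next lemma, one into it, whatever the labels. *)
Lemma converse_out_eq x y y' l l' :
  (x, y, l) \in carrows -> (x, y', l') \in carrows -> y = y' /\ l = l'.
Proof.
case: l l' => [] []; rewrite !inE /= => xy xy'.
- by rewrite (kraft_head_eq kG xy xy').
- by case/negP: (kraft_alternate kG y xy').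
- by case/negP: (kraft_alternate kG y' xy).
- by rewrite (kraft_tail_eq kG xy xy').
Qed.

Lemma converse_in_eq x x' y l l' :
  (x, y, l) \in carrows -> (x', y, l') \in carrows -> x = x' /\ l = l'.
Proof.
case: l l' => [] []; rewrite !inE /= => xy x'y.
- by rewrite (kraft_tail_eq kG xy x'y).
- by case/negP: (kraft_alternate kG x' xy).
- by case/negP: (kraft_alternate kG x x'y).
- by rewrite (kraft_head_eq kG xy x'y).
Qed.

Lemma same_type_converse x x' y l : same_type x y -> (x, x', l) \in carrows ->
  exists2 y', (y, y', l) \in carrows & same_type x' y'.
Proof.
move=> xy; case: l; rewrite inE => /= xx'.
  have [y' yy' x'y'] := same_type_head kG kG xy xx'.
  by exists y'; rewrite // inE.
have [y' yy' x'y'] := same_type_tail kG kG xy xx'.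
by exists y'; rewrite // inE.
Qed.

Lemma adjacent_converse x y : adjacent x y ->
  exists l, (x, y, l) \in carrows \/ (y, x, l) \in carrows.
Proof.
case/existsP=> -[] /orP[] xy.
- by exists SF; left; rewrite inE.
- by exists SF; right; rewrite inE.
- by exists SVsharp; right; rewrite inE.
- by exists SVsharp; left; rewrite inE.
Qed.

Lemma converse_adjacent x y l : (x, y, l) \in carrows -> adjacent x y.
Proof.
case: l; rewrite inE => /adjacent_arrow //.
by rewrite adjacent_sym.
Qed.

(** Sinks of the converse graph are fixed points, so [next] is total and its orbits describe the
    directed paths. *)
Definition next x :=
  if [pick p | (x, p.1, p.2) \in carrows] is Some p then p.1 else x.

Definition clabel x := if (x, next x, SF) \in carrows then SF else SVsharp.

Lemma next_eq x y l : (x, y, l) \in carrows -> next x = y.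
Proof.
rewrite /next => xy; case: pickP => [p xp|/(_ (y, l))]; last by rewrite xy.
by case: (converse_out_eq xp xy).
Qed.

Variant next_spec x : G -> Prop :=
  | NextArrow of (x, next x, clabel x) \in carrows : next_spec x (next x)
  | NextSink of (forall y l, (x, y, l) \notin carrows) : next_spec x x.

Lemma nextP x : next_spec x (next x).
Proof.
have [/existsP[[y l] xy]|/existsPn no] :=
    boolP [exists p : G * sharp_letter, (x, p.1, p.2) \in carrows].
  constructor; rewrite /clabel (next_eq xy).
  by case: l xy; case: ifP => // ->.
rewrite /next; case: pickP => [p xp|_]; first by case/negP: (no p).
by constructor=> y l; apply: (no (y, l)).
Qed.

Lemma next_same_type x y : same_type x y -> same_type (next x) (next y).
Proof.
move=> xy; case: (nextP x) => [xx'|no].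
  have [y' yy' x'y'] := same_type_converse xy xx'.
  by rewrite (next_eq yy').
case: (nextP y) => [yy'|//]; have := same_type_sym xy.
by case/same_type_converse/(_ yy') => x'; rewrite (negPf (no _ _)).
Qed.

Lemma iter_next_same_type i x y :
  same_type x y -> same_type (iter i next x) (iter i next y).
Proof. by elim: i => //= i IH /IH/next_same_type. Qed.

(** Without branching, an undirected walk only goes back and forth on one directed path. *)
Lemma connect_adjacent_iter v u : connect (@adjacent _ G) v u ->
  (exists k, u = iter k next v) \/ (exists k, v = iter k next u).
Proof.
case/connectP=> p; elim: p v => [|x p IH] v /=; first by left; exists 0.
case/andP=> /adjacent_converse[l vx] xp eu.
case: (IH x xp eu) vx => -[k e] [] vx.
- by left; exists k.+1; rewrite iterSr (next_eq vx).
- case: k e => [|k]; first by right; exists 1; rewrite e /= (next_eq vx).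
  by rewrite iterSr (next_eq vx) => ->; left; exists k.
- elim: k e => [|k IHk]; first by left; exists 1; rewrite /= (next_eq vx).
  (* Either the last step is an arrow into [x], whose tail can only be [v], or it rests at a sink
     and a smaller [k] works. *)
  rewrite iterS; case: (nextP (iter k next u)) => // zx e.
  rewrite -e in zx; have [<- _] := converse_in_eq zx vx.
  by right; exists k.
- by right; exists k.+1; rewrite iterS -e (next_eq vx).
Qed.

End Converse.

(** * A type that recurs along a path *)

Section Repetition.
Variables (G : quiver) (kG : kraft G) (v : G) (k : nat).
Hypotheses (vk : same_type v (iter k (@next G) v))
  (nvk : iter k (@next G) v != v).
Notation f := (@next G).
Notation carrows := (arrows (converse G)).

Let k_gt0 : 0 < k. Proof. by case: (k) nvk; rewrite ?eqxx. Qed.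

Let iter_mul_same_type a : same_type (iter (a * k) f v) v.
Proof.
elim: a => [|a IH] //; rewrite mulSn iterD.
exact: same_type_trans (iter_next_same_type kG k IH) (same_type_sym vk).
Qed.

(** A sink on the orbit would absorb it and so equal [iter (i * k) f v], which has the type of [v].
    Then [v] would have no arrow out either and would be fixed by [f]. *)
Let iter_arrow i : (iter i f v, iter i.+1 f v, clabel (iter i f v)) \in carrows.
Proof.
rewrite iterS; case: (nextP kG (iter i f v)) => // sink.
have fz : f (iter i f v) = iter i f v.
  by case: (nextP kG (iter i f v)) => // zz; rewrite (negPf (sink _ _)) in zz.
have fzz j : iter j f (iter i f v) = iter i f v by elim: j => //= j ->.
have := iter_mul_same_type i.
rewrite -(subnK (leq_pmulr i k_gt0)) iterD fzz => zv.
case/eqP: nvk; elim: (k) => //= j ->.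
case: (nextP kG v) => // vv'.
have [y] := same_type_converse kG (same_type_sym zv) vv'.
by rewrite (negPf (sink _ _)).
Qed.

Let iter_cancel i m : iter (m + i) f v = iter i f v -> iter m f v = v.
Proof.
elim: i => [|i IH]; first by rewrite addn0.
rewrite addnS => e; apply: IH.
have := iter_arrow (m + i); rewrite e => h.
by case: (converse_in_eq kG h (iter_arrow i)).
Qed.

Let n := order f v.

Let iter_n : iter n f v = v.
Proof.
(* The finite orbit runs into itself at some [iter i f v]; cancelling [i] steps closes the loop at
   [v]. The equivalence turns any return to [v] into one after exactly [order f v] steps. *)
apply/(orbitPcycle 3 4); have /trajectP[i lt_in e] := looping_order f v.
exists (n - i).-1; rewrite prednK ?subn_gt0 //.
by apply: (@iter_cancel i); rewrite subnK // ltnW.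
Qed.

Let iter_mod i : iter (i %% n) f v = iter i f v.
Proof.
rewrite [in RHS](divn_eq i n) addnC iterD.
by congr iter; elim: (i %/ n) => //= q IH; rewrite mulSn iterD -IH iter_n.
Qed.

Let iter_orbit x : fconnect f v (f x) -> fconnect f v x.
Proof.
case: (nextP kG x) => // xx' /iter_findex e.
have := iter_arrow (findex f v (f x) + n.-1).
have -> : iter (findex f v (f x) + n.-1).+1 f v = f x.
  by rewrite -addnS prednK ?order_gt0 // iterD iter_n e.
move=> h.
case: (converse_in_eq kG xx' h) => -> _.
exact: fconnect_iter.
Qed.

Let C := [set w | connect (@adjacent _ G) v w].

Let component_orbit x : (x \in C) = fconnect f v x.
Proof.
rewrite inE; apply/idP/idP => [|/iter_findex <-].
  case/(connect_adjacent_iter kG) => -[j].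
    by move=> ->; apply: fconnect_iter.
  move=> e; have: fconnect f v (iter j f x) by rewrite -e connect0.
  by elim: j {e} => //= j IH /iter_orbit.
elim: findex => [|j IH]; first exact: connect0.
exact: connect_trans IH (connect1 (converse_adjacent (iter_arrow j))).
Qed.

(** The component is the cycle of length [n] traced by [next]. Types, hence labels, are invariant
    under a shift by [k], hence by [gcdn k n], which is less than [n] because a shift by [k] moves
    [v]. *)
Lemma component_has_repetitions :
  circular (induced C) /\ has_repetitions (induced C).
Proof.
have inC i : iter i f v \in C by rewrite component_orbit fconnect_iter.
pose w (i : 'I_n) : induced C := Sub (iter i f v) (inC i).
pose lab (i : 'I_n) := clabel (iter i f v).
have ltC (x : induced C) : findex f v (val x) < n.
  by rewrite findex_max // -component_orbit; apply: valP.
have co : circular_order w lab.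
  split.
    exists (fun x => Ordinal (ltC x)) => [i|x]; apply: val_inj => /=.
      by rewrite findex_iter.
    by rewrite iter_findex // -component_orbit; apply: valP.
  apply/setP => -[[x y] l].
  have -> : ((x, y, l) \in arrows (converse (induced C))) =
      ((val x, val y, l) \in carrows) by rewrite !inE; case: l; rewrite /= ?inE.
  apply/idP/imsetP => [xy|[i _ [-> -> ->]]]; last first.
    by rewrite /= iter_mod; apply: iter_arrow.
  exists (Ordinal (ltC x)) => //.
  have ex : iter (findex f v (val x)) f v = val x.
    by rewrite iter_findex // -component_orbit; apply: valP.
  have := iter_arrow (findex f v (val x)); rewrite iterS ex => h.
  have [ey el] := converse_out_eq kG xy h.
  congr (_, _, _); last by rewrite /lab /= ex.
    by apply: val_inj; rewrite /= ex.
  by apply: val_inj; rewrite /= iter_mod iterS ex.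
split; first by exists n, w, lab.
exists n, w, lab; split=> //; exists (gcdn k n); split.
- rewrite gcdn_gt0 k_gt0 /= ltn_neqAle dvdn_leq ?dvdn_gcdr ?order_gt0 // andbT.
  apply: contraNneq nvk => e; have : n %| k by rewrite -e dvdn_gcdl.
  by move=> /eqP nk; rewrite -iter_mod nk.
- exact: dvdn_gcdr.
move=> i; rewrite /lab val_iter_ordS iter_mod.
(* Bezout: [a * k] and [gcdn k n] agree modulo [n], so shifting by [gcdn k n] amounts to shifting
   [a] times by [k]. *)
case: (egcdnP n k_gt0) => a b e _.
have st : same_type (iter i f v) (iter (i + gcdn k n) f v).
  have -> : iter (i + gcdn k n) f v = iter i f (iter (a * k) f v).
    rewrite -iterD e -[LHS]iter_mod -[RHS]iter_mod addnCA addnC.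
    by rewrite modnMDl.
  exact/iter_next_same_type/same_type_sym.
have [y h _] := same_type_converse kG st (iter_arrow i).
by case: (converse_out_eq kG h (iter_arrow _)).
Qed.

End Repetition.

Section Separated.
Variables (G : quiver) (kG : kraft G).
Hypotheses (nonisoG : components_non_isomorphic G)
  (norepG : circular_components_no_repetitions G).

(** One vertex is an iterate of the other, and a recurring type would make the component circular
    with repetitions. *)
Lemma same_type_component_inj (v u : G) :
  connect (@adjacent _ G) v u -> same_type v u -> v = u.
Proof.
wlog [k eu] : v u / exists k, u = iter k (@next G) v.
  move=> IH vu st.
  case: (connect_adjacent_iter kG vu) => ex; first exact: IH.
  by apply/esym/IH; rewrite // connect_adjacent_sym.
move=> _ st; apply/eqP/negPn/negP => ne.
have [] := @component_has_repetitions G kG v k.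
- by rewrite -eu.
- by rewrite -eu eq_sym.
by apply: norepG; apply: imset_f.
Qed.

Lemma same_type_connect (v u x : G) : same_type v u ->
  connect (@adjacent _ G) v x ->
  exists2 y, connect (@adjacent _ G) u y & same_type x y.
Proof.
move=> vu /connectP[p vp ->] {x}.
elim: p v u vu vp => [|x p IH] v u vu /=; first by exists u.
case/andP=> /existsP[l vx] xp.
have [y uy xy] : exists2 y, adjacent u y & same_type x y.
  case/orP: vx => vx.
    have [y uy xy] := same_type_head kG kG vu vx.
    by exists y => //; apply: adjacent_arrow uy.
  have [y uy xy] := same_type_tail kG kG vu vx.
  by exists y => //; rewrite adjacent_sym; apply: adjacent_arrow uy.
have [z yz] := IH _ _ xy xp.
by exists z => //; apply: connect_trans (connect1 uy) yz.
Qed.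

(** Inside one component types are distinct. For two components, copying walks arrow by arrow
    matches vertices of equal type, and the matching would be an isomorphism of the components. *)
Lemma components_separated : separated G.
Proof.
move=> v u vu.
pose Cp w := [set x | connect (@adjacent _ G) w x].
have hCp w : Cp w \in components G by apply: imset_f.
have [e|ne] := eqVneq (Cp v) (Cp u).
  apply: same_type_component_inj vu.
  by have: u \in Cp u; [rewrite inE connect0 | rewrite -e inE].
have partner w z : same_type w z -> exists h : induced (Cp w) -> induced (Cp z),
    forall x, same_type (val x) (val (h x)).
  move=> wz.
  apply: (@fin_all_exists _ _ (fun x y => same_type (val x) (val y))) => x.
  have: val x \in Cp w by apply: valP.
  rewrite inE => wx.
  have [y zy xy] := same_type_connect wz wx.
  have yC : y \in Cp z by rewrite inE.
  by exists (Sub y yC).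
have [f fP] := partner v u vu; have [g gP] := partner u v (same_type_sym vu).
have inj w (x y : induced (Cp w)) : same_type (val x) (val y) -> x = y.
  move=> xy; apply: val_inj; apply: same_type_component_inj xy.
  by apply: (component_connect (hCp w)); apply: valP.
have arr w z (h : induced (Cp w) -> induced (Cp z)) :
    (forall x, same_type (val x) (val (h x))) -> forall x y l,
    (val x, val y, l) \in arrows G -> (val (h x), val (h y), l) \in arrows G.
  move=> hP x y l xy; have [y' hxy' yy'] := same_type_head kG kG (hP x) xy.
  have y'C : y' \in Cp z.
    by rewrite -(component_arrow (hCp z) hxy'); apply: valP.
  have -> // : h y = Sub y' y'C.
  by apply: inj; apply: same_type_trans yy'; apply/same_type_sym.
case: (nonisoG (hCp v) (hCp u) ne); exists f.
have fK : cancel f g.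
  by move=> x; apply/esym/inj/(same_type_trans (fP x))/gP.
have gK : cancel g f.
  by move=> x; apply/esym/inj/(same_type_trans (gP x))/fP.
split; first by exists g.
move=> x y l; rewrite !inE /=; apply/idP/idP; last exact: arr.
by move/(arr _ _ _ gP); rewrite !fK.
Qed.

End Separated.

(** * Uniqueness *)

Local Open Scope ring_scope.

Section Operators.
Variables (K : fieldType) (sigma tau : {rmorphism K -> K}).

Definition op (N : twisted_space sigma tau) l :
    {linear N -> N | twist sigma tau l \; *:%R} :=
  match l with LF => opF N | LV => opV N end.

Lemma op_attached (G : quiver) (R : representation sigma tau G) l :
  op (attached_module R) l = attached_map R l.
Proof. by case: l. Qed.

(** Module counterpart of [word_set]; being a predicate, it avoids showing that images under
    twisted-linear maps are subspaces. *)
Fixpoint word_mem (N : twisted_space sigma tau) e (w : seq (bool * letter))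
    (x : N) : Prop :=
  match w with
  | [::] => ~~ e -> x = 0
  | (true, l) :: w' => exists2 y, word_mem e w' y & x = op N l y
  | (false, l) :: w' => word_mem e w' (op N l x)
  end.

Lemma word_mem_hom (N P : twisted_space sigma tau) (f : {linear N -> P}) :
    (forall l x, f (op N l x) = op P l (f x)) ->
  forall e w x, word_mem e w x -> word_mem e w (f x).
Proof.
move=> fop e; elim=> [|[[] l] w IH] x /=.
- by move=> x0 /x0->; rewrite linear0.
- by case=> y /IH fy ->; exists (f y); rewrite ?fop.
- by move/IH; rewrite fop.
Qed.

Lemma module_isomorphic_inverse (N P : twisted_space sigma tau) :
  module_isomorphic N P ->
  exists (f : {linear N -> P}) (g : {linear P -> N}),
    [/\ cancel f g, cancel g f, forall l x, f (op N l x) = op P l (f x)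
      & forall l x, g (op P l x) = op N l (g x)].
Proof.
case=> f [[g0 fK gK] fF fV].
have g0_linear : linear g0.
  by move=> a x y; apply: (can_inj fK); rewrite linearP !gK.
pose g : {linear P -> N} :=
  HB.pack g0 (GRing.isLinear.Build K _ _ _ _ g0_linear).
have fop l x : f (op _ l x) = op _ l (f x) by case: l.
exists f, g; split=> // l x.
by apply: (can_inj fK); rewrite fop !gK.
Qed.

Lemma module_isomorphic_sym (N P : twisted_space sigma tau) :
  module_isomorphic N P -> module_isomorphic P N.
Proof.
case/module_isomorphic_inverse=> f [g [fK gK _ gop]]; exists g.
by split=> [|x|x]; [exists f | apply: (gop LF) | apply: (gop LV)].
Qed.

Lemma module_isomorphic_trans (N P Q : twisted_space sigma tau) :
  module_isomorphic N P -> module_isomorphic P Q -> module_isomorphic N Q.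
Proof.
case=> f [f_bij fF fV] [g [g_bij gF gV]]; exists (g \o f).
split=> [|x|x] /=; [exact: bij_comp | by rewrite fF gF | by rewrite fV gV].
Qed.

Section Attached.
Variables (G : quiver) (R : representation sigma tau G).
Hypotheses (kG : kraft G) (sR : strict R).
Notation U := (repr_space R).
Implicit Types x y : dirsum U.

Lemma op_attached_head l u v x : (u, v, l) \in arrows G ->
  (op (attached_module R) l x : dirsum U) v = repr_map R l u v (x u).
Proof.
move=> uv; rewrite op_attached ffunE (bigD1 u) //= big1 ?addr0 // => u'.
by case/andP=> u'v; rewrite (kraft_tail_eq kG u'v uv) eqxx.
Qed.

Lemma op_attached_no_arrow l v x : (forall u, (u, v, l) \notin arrows G) ->
  (op (attached_module R) l x : dirsum U) v = 0.
Proof.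
move=> no; rewrite op_attached ffunE big1 // => u uv.
by rewrite (negPf (no u)) in uv.
Qed.

Lemma repr_map_eq0 u v l (a : U u) :
  (u, v, l) \in arrows G -> (repr_map R l u v a == 0) = (a == 0).
Proof.
by move/sR => bij; rewrite -(inj_eq (bij_inj bij)) linear0.
Qed.

(** Along arrows the operators are bijections between vertex spaces and elsewhere they vanish, so
    images and preimages of sums of vertex spaces are again such sums. *)
Lemma word_mem_attached e w x : word_mem (N := attached_module R) e w x <->
  forall v, x v != 0 -> word_set e w v.
Proof.
elim: w x => [|[[] l] w IH] x /=.
- split=> [x0 v|x0].
    by case: e x0 => // -> //; rewrite dirsum0E eqxx.
  case: e x0 => // x0 _; apply/ffunP => v; rewrite dirsum0E.
  by apply/eqP; apply: contraT => /x0.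
- split=> [[y /IH hy ->] v|hx].
    move=> xv; apply: contraT => /existsPn no.
    case/eqP: xv; rewrite op_attached ffunE big1 // => u uv.
    have := no u; rewrite uv => /= nu; apply/eqP; rewrite repr_map_eq0 //.
    by apply: contraNT nu => /hy.
  (* The preimage is chosen coordinate by coordinate: each [u] has at most one [l]-arrow out, and
     gets [0] if it has none. *)
  have: forall u, exists yu : U u, (yu != 0 -> word_set e w u) /\
      forall v, (u, v, l) \in arrows G -> repr_map R l u v yu = x v.
    move=> u; have [/existsP[v uv]|/existsPn no] :=
        boolP [exists v, (u, v, l) \in arrows G]; last first.
      by exists 0; split=> [|v]; rewrite ?eqxx // (negPf (no v)).
    have [g _ gK] := sR uv; exists (g (x v)).
    split=> [|v' uv']; last by rewrite -(kraft_head_eq kG uv uv') gK.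
    rewrite -(repr_map_eq0 _ uv) gK => /hx/existsP[u' /andP[u'v]].
    by rewrite (kraft_tail_eq kG u'v uv).
  case/(@fin_all_exists _ _ (fun u yu => _)) => y hy.
  pose y' : dirsum U := [ffun u => y u].
  exists (y' : attached_module R).
    by apply/IH => v; rewrite ffunE; case: (hy v).
  apply/ffunP => v.
  have [/existsP[u uv]|/existsPn no] :=
      boolP [exists u, (u, v, l) \in arrows G].
    by rewrite (op_attached_head _ uv) ffunE; case: (hy u) => _ ->.
  rewrite op_attached_no_arrow //; apply/eqP; apply: contraT.
  by case/hx/existsP=> u; rewrite (negPf (no u)).
- apply: (iff_trans (IH _)); split=> h v xv.
    apply/forallP => u; apply/implyP => vu; apply: h.
    by rewrite (op_attached_head _ vu) repr_map_eq0.
  have [/existsP[u uv]|/existsPn no] :=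
      boolP [exists u, (u, v, l) \in arrows G]; last first.
    by rewrite op_attached_no_arrow ?eqxx // in xv.
  rewrite (op_attached_head _ uv) repr_map_eq0 // in xv.
  by have /forallP/(_ v) := h _ xv; rewrite uv.
Qed.

End Attached.

Section DirsumInjection.
Variables (I : finType) (U : I -> vectType K).

Definition dirsum_inj (i : I) (a : U i) : dirsum U :=
  [ffun j => @dfwith I (fun k => U k : Type) (fun k => 0) i a j].

Lemma dirsum_inj_in i (a : U i) : dirsum_inj a i = a.
Proof. by rewrite ffunE dfwith_in. Qed.

Lemma dirsum_inj_out i j (a : U i) : i != j -> dirsum_inj a j = 0.
Proof. by move=> ij; rewrite ffunE dfwith_out. Qed.

Fact dirsum_inj_linear i : linear (@dirsum_inj i).
Proof.
move=> a x y; apply/ffunP => j; rewrite dirsumDE dirsumZE.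
have [<-|ij] := eqVneq i j; first by rewrite !dirsum_inj_in.
by rewrite !dirsum_inj_out // scaler0 addr0.
Qed.

HB.instance Definition _ i := GRing.isLinear.Build K _ _ _ _
  (@dirsum_inj_linear i).

Definition dirsum_proj (i : I) (x : dirsum U) : U i := x i.

Fact dirsum_proj_linear i : linear (@dirsum_proj i).
Proof. by move=> a x y; rewrite /dirsum_proj dirsumDE dirsumZE. Qed.

HB.instance Definition _ i := GRing.isLinear.Build K _ _ _ _
  (@dirsum_proj_linear i).

Lemma dirsum_sum J (r : seq J) (P : pred J) (F : J -> dirsum U) i :
  (\sum_(j <- r | P j) F j) i = \sum_(j <- r | P j) F j i.
Proof. exact: (linear_sum (@dirsum_proj i)). Qed.

Lemma dirsum_decomp (x : dirsum U) : x = \sum_i dirsum_inj (x i).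
Proof.
apply/ffunP => i; rewrite dirsum_sum (bigD1 i) //= dirsum_inj_in.
by rewrite big1 ?addr0 // => j ji; rewrite dirsum_inj_out.
Qed.

End DirsumInjection.

(** * Blocks of homomorphisms between attached modules *)

Section Blocks.
Variables (G H : quiver) (R : representation sigma tau G).
Variables (S : representation sigma tau H).
Variable f : {linear attached_module R -> attached_module S}.

Definition block v u (a : repr_space R v) : repr_space S u :=
  dirsum_proj u (f (dirsum_inj a)).

Fact block_linear v u : linear (@block v u).
Proof. by move=> a x y; rewrite /block !linearP. Qed.

HB.instance Definition _ v u := GRing.isLinear.Build K _ _ _ _
  (@block_linear v u).

Hypotheses (kG : kraft G) (kH : kraft H) (sR : strict R) (sS : strict S).
Hypothesis fop : forall l x, f (op _ l x) = op _ l (f x).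

(** Triangularity: a homomorphism preserves the subspaces defined by words, and these are sums of
    vertex spaces. *)
Lemma block_word_set v u (a : repr_space R v) e w :
  block u a != 0 -> word_set e w v -> word_set e w u.
Proof.
move=> fa ev.
have /(word_mem_hom fop)/(word_mem_attached kH sS) :
    word_mem (N := attached_module R) e w (dirsum_inj a).
  apply/(word_mem_attached kG sR) => v'.
  have [<-//|vv'] := eqVneq v v'.
  by rewrite dirsum_inj_out ?eqxx.
exact.
Qed.

Lemma block_arrow v u v' u' l (a : repr_space R v) :
  (v, v', l) \in arrows G -> (u, u', l) \in arrows H ->
  block u' (repr_map R l v v' a) = repr_map S l u u' (block u a).
Proof.
move=> vv' uu'; rewrite /block /dirsum_proj -(op_attached_head kH _ uu') -fop.
suff -> : dirsum_inj (repr_map R l v v' a) =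
  op (attached_module R) l (dirsum_inj a) by [].
apply/ffunP => x.
have [<-|v'x] := eqVneq v' x.
  by rewrite (op_attached_head kG _ vv') !dirsum_inj_in.
rewrite dirsum_inj_out // op_attached ffunE big1 // => y yx.
have [vy|vy] := eqVneq v y; last by rewrite dirsum_inj_out ?linear0.
by case/eqP: v'x; apply: (kraft_head_eq kG vv'); rewrite vy.
Qed.

End Blocks.

Section InverseBlocks.
Variables (G H : quiver) (R : representation sigma tau G).
Variables (S : representation sigma tau H).
Variables (f : {linear attached_module R -> attached_module S})
  (g : {linear attached_module S -> attached_module R}).
Hypothesis fK : cancel f g.

Lemma block_inverse v (a : repr_space R v) :
  a = \sum_u block g v (block f u a).
Proof.
rewrite -[LHS]dirsum_inj_in -[dirsum_inj a]fK.
rewrite [f _]dirsum_decomp linear_sum dirsum_sum.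
by [].
Qed.

Hypotheses (kG : kraft G) (kH : kraft H) (sR : strict R) (sS : strict S).
Hypotheses (fop : forall l x, f (op _ l x) = op _ l (f x))
  (gop : forall l x, g (op _ l x) = op _ l (g x)).

(* The block f_(u, v) vanishes unless every word set containing v contains u;
   so only vertices of the type of v contribute to the diagonal block at v of
   the composite of f with its inverse. *)
Lemma block_same_type v u (a : repr_space R v) :
  block g v (block f u a) != 0 -> same_type v u.
Proof.
move=> ne e w; apply/idP/idP; last exact: (block_word_set kH kG sS sR gop ne).
apply: (block_word_set kG kH sR sS fop (a := a)).
by apply: contraNneq ne => ->; rewrite linear0.
Qed.

(** A nonzero vector at [v] is the sum of its round trips through all [u], so one of these is
    nonzero. *)
Lemma exists_same_type : nowhere_zero R ->
  forall v : G, exists u : H, same_type v u.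
Proof.
move=> nzR v; have := nzR v; rewrite lt0n dimv_eq0 => /eqP nz.
have [a na] : exists a : repr_space R v, a != 0.
  exists (vpick {:repr_space R v}%VS); rewrite vpick0; exact/eqP.
have [/existsP[u nu]|/existsPn no] :=
    boolP [exists u, block g v (block f u a) != 0].
  by exists u; apply: block_same_type nu.
case/eqP: na; rewrite [a]block_inverse big1 // => u _.
by apply/eqP; rewrite -[_ == _]negbK.
Qed.

Hypothesis sepH : separated H.

Lemma block_diag_inverse v u (a : repr_space R v) : same_type v u ->
  block g v (block f u a) = a.
Proof.
move=> vu; rewrite [RHS]block_inverse (bigD1 u) //= big1 ?addr0 // => u' ne.
apply/eqP; apply: contraNT ne => /block_same_type vu'.
by apply/eqP/sepH; apply: same_type_trans vu; apply: same_type_sym.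
Qed.

End InverseBlocks.

Lemma attached_module_unique (G H : quiver) (R : representation sigma tau G)
    (S : representation sigma tau H) :
    kraft G -> kraft H -> separated G -> separated H ->
    strict R -> strict S -> nowhere_zero R -> nowhere_zero S ->
    module_isomorphic (attached_module R) (attached_module S) ->
  exists f : G -> H, graph_iso f /\ repr_isomorphic_along f R S.
Proof.
move=> kG kH sepG sepH sR sS nzR nzS /module_isomorphic_inverse.
case=> f [g [fK gK fop gop]].
have /fin_all_exists[p vp] := exists_same_type fK kG kH sR sS fop gop nzR.
have /fin_all_exists[q uq] :=
  exists_same_type (g := f) gK kH kG sS sR gop fop nzS.
have pK : cancel p q.
  move=> v; apply: sepG; apply: same_type_trans (same_type_sym (vp v)).
  exact/same_type_sym.
have qK : cancel q p.
  move=> u; apply: sepH; apply: same_type_trans (same_type_sym (uq u)).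
  exact/same_type_sym.
have p_arrow u v l : (u, v, l) \in arrows G -> (p u, p v, l) \in arrows H.
  move=> uv; have [v' pv' vv'] := same_type_head kG kH (vp u) uv.
  suff -> : p v = v' by [].
  by apply: sepH; apply: same_type_trans vv'; apply: same_type_sym.
have q_arrow u v l : (u, v, l) \in arrows H -> (q u, q v, l) \in arrows G.
  move=> uv; have [v' pv' vv'] := same_type_head kH kG (uq u) uv.
  suff -> : q v = v' by [].
  by apply: sepG; apply: same_type_trans vv'; apply: same_type_sym.
exists p; split.
  split; first by exists q.
  by move=> u v l; apply/idP/idP => [/q_arrow|/p_arrow] //; rewrite !pK.
exists (fun v => block f (p v)); split=> [v|u v l uv x].
  exists (block g v) => x.
    exact: (block_diag_inverse fK kG kH sR sS fop gop sepH).
  apply: (block_diag_inverse (g := f) gK kH kG sS sR gop fop sepG).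
  exact: same_type_sym.
by apply: block_arrow => //; apply: p_arrow.
Qed.

End Operators.

(** * The quiver of a module *)

(** Starting from [0], lines inside [P] are adjoined until none is left; [k] bounds the remaining
    codimension. *)
Lemma subspace_vspace (K : fieldType) (vT : vectType K) (P : vT -> Prop) :
    P 0 -> (forall a x y, P x -> P y -> P (a *: x + y)) ->
  exists U : {vspace vT}, forall x, x \in U <-> P x.
Proof.
move=> P0 PD.
have [k le_k] : exists k, (\dim {:vT} - \dim (0%VS : {vspace vT}) <= k)%N.
  by exists (\dim {:vT}); rewrite leq_subr.
have : forall x, x \in (0%VS : {vspace vT}) -> P x.
  by move=> x; rewrite memv0 => /eqP->.
elim: k (0%VS : {vspace vT}) le_k => [|k IH] U le_k PU.
  exists U => x; split=> [/PU//|_]; suff -> : U = fullv by rewrite memvf.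
  by apply/eqP; rewrite eqEdim subvf -subn_eq0 -leqn0.
have [[x Px /negP xU]|no] := classic (exists2 x, P x & ~ x \in U); last first.
  exists U => x; split=> [/PU//|Px]; apply: NNPP => xU.
  by apply: no; exists x.
apply: (IH (<[x]> + U)%VS).
  have ltU : (\dim U < \dim (<[x]> + U))%N.
    rewrite ltnNge; apply: contra xU => le_dim.
    have /eqP eqU : U == (<[x]> + U)%VS by rewrite eqEdim addvSr.
    by rewrite eqU; apply: subvP (addvSl _ _) _ (memv_line x).
  by rewrite leq_subLR; rewrite leq_subLR in le_k; apply: leq_trans le_k _;
    rewrite -addSnnS leq_add2r.
move=> z /memv_addP[y /vlineP[a ->] [u uU ->]].
by apply: PD => //; apply: PU.
Qed.

(** * The two chains of subspaces and their steps *)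

Section Chains.
Variables (K : fieldType) (sigma tau : {rmorphism K -> K}).
Hypotheses (sigma_bij : bijective sigma) (tau_bij : bijective tau).
Variable M : twisted_space sigma tau.
Hypothesis M_GP : gelfand_ponomarev M.
Implicit Types (U W L H : {vspace M}) (l : letter) (x y : M).

Notation op := (op M).

Lemma twist_bij l : bijective (twist sigma tau l).
Proof. by case: l. Qed.

Lemma op_other l x : op (other l) (op l x) = 0.
Proof. by case: l; case: (M_GP x). Qed.

Lemma img_exists l U :
  exists W : {vspace M}, forall y, y \in W <-> exists2 x, x \in U & y = op l x.
Proof.
apply: subspace_vspace => [|a _ _ [x xU ->] [y yU ->]].
  by exists 0; rewrite ?mem0v ?linear0.
(* A scalar enters [op l] through the inverse of the twist. *)
have [s _ sK] := twist_bij l.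
exists (s a *: x + y); first by rewrite rpredD ?rpredZ.
by rewrite linearP /= sK.
Qed.

Lemma pre_exists l U :
  exists W : {vspace M}, forall x, x \in W <-> op l x \in U.
Proof.
apply: (@subspace_vspace _ _ (fun x => op l x \in U)) => [|a x y xU yU].
  by rewrite linear0 mem0v.
by rewrite linearP rpredD ?rpredZ.
Qed.

Definition img l U : {vspace M} :=
  sval (constructive_indefinite_description _ (img_exists l U)).

Definition pre l U : {vspace M} :=
  sval (constructive_indefinite_description _ (pre_exists l U)).

Lemma imgP l U y : y \in img l U <-> exists2 x, x \in U & y = op l x.
Proof. by rewrite /img; case: constructive_indefinite_description. Qed.

Lemma mem_img l U x : x \in U -> op l x \in img l U.
Proof. by move=> xU; apply/imgP; exists x. Qed.

Lemma mem_pre l U x : (x \in pre l U) = (op l x \in U).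
Proof.
rewrite /pre; case: constructive_indefinite_description => W /= WE.
by apply/idP/idP => /WE.
Qed.

Lemma imgS l U W : (U <= W)%VS -> (img l U <= img l W)%VS.
Proof.
by move=> UW; apply/subvP => _ /imgP[x xU ->]; apply/mem_img/(subvP UW).
Qed.

Lemma preS l U W : (U <= W)%VS -> (pre l U <= pre l W)%VS.
Proof. by move=> UW; apply/subvP => x; rewrite !mem_pre; apply: (subvP UW). Qed.

Lemma img_sub_pre l U W : (img l U <= pre (other l) W)%VS.
Proof.
apply/subvP => _ /imgP[x _ ->]; rewrite mem_pre.
by rewrite op_other mem0v.
Qed.

Lemma img0 l : img l 0%VS = 0%VS.
Proof.
apply/eqP; rewrite -subv0; apply/subvP => _ /imgP[x + ->].
by rewrite memv0 => /eqP->; rewrite linear0 mem0v.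
Qed.

Lemma preT l : pre l fullv = fullv.
Proof. by apply/vspaceP => x; rewrite mem_pre !memvf. Qed.

Inductive chain l : {vspace M} -> Prop :=
  | chain0 : chain l 0%VS
  | chainT : chain l fullv
  | chain_img U : chain l U -> chain l (img l U)
  | chain_pre U : chain l U -> chain l (pre (other l) U).

(** [op (other l)] kills every image under [op l], so images lie below preimages; members of the
    same kind compare as their arguments do. *)
Lemma chain_total l U W : chain l U -> chain l W -> (U <= W)%VS \/ (W <= U)%VS.
Proof.
move=> cU; elim: cU W => [||{}U _ IH|{}U _ IH] W.
- by left; apply: sub0v.
- by right; apply: subvf.
- case=> [||{}W /IH[] UW|{}W _].
  + by right; apply: sub0v.
  + by left; apply: subvf.
  + by left; apply: imgS.
  + by right; apply: imgS.
  + by left; apply: img_sub_pre.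
- case=> [||{}W _|{}W /IH[] UW].
  + by right; apply: sub0v.
  + by left; apply: subvf.
  + by right; apply: img_sub_pre.
  + by left; apply: preS.
  + by right; apply: preS.
Qed.

(** In a chain the dimension determines the member, so raising [d] by one admits at most one new
    member. The bound [d.-1] also covers [d = 0]. *)
Lemma lev_exists l d : exists W, [/\ chain l W, (\dim W <= d.-1)%N &
  forall U, chain l U -> (\dim U < d)%N -> (U <= W)%VS].
Proof.
elim: d => [|d [W [cW dW WU]]].
  by exists 0%VS; split; rewrite ?dimv0 //; apply: chain0.
have [[V cV dV]|no] := classic (exists2 V, chain l V & \dim V = d).
  exists V; split=> // [|U cU]; first by rewrite dV.
  rewrite ltnS -dV => le_dim; have [//|VU] := chain_total cU cV.
  suff -> : V = U by [].
  by apply/eqP; rewrite eqEdim VU.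
exists W; split=> // [|U cU]; first by apply: leq_trans dW (leq_pred d).
rewrite ltnS leq_eqVlt => /orP[/eqP dU|]; last exact: WU.
by case: no; exists U.
Qed.

(* The largest member of the chain of dimension less than d (0 if d = 0). *)
Definition lev l d : {vspace M} :=
  sval (constructive_indefinite_description _ (lev_exists l d)).

Lemma levP l d : [/\ chain l (lev l d), (\dim (lev l d) <= d.-1)%N &
  forall U, chain l U -> (\dim U < d)%N -> (U <= lev l d)%VS].
Proof. by rewrite /lev; case: constructive_indefinite_description. Qed.

Lemma chain_lev l d : chain l (lev l d).
Proof. by case: (levP l d). Qed.

Lemma lev0 l : lev l 0 = 0%VS.
Proof. by have [_ + _] := levP l 0; rewrite leqn0 dimv_eq0 => /eqP. Qed.

Lemma lev_full l : lev l (\dim {:M}).+1 = fullv.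
Proof.
apply/eqP; rewrite eqEsubv subvf; case: (levP l (\dim {:M}).+1) => _ _; apply.
  exact: chainT.
exact: ltnSn.
Qed.

Lemma lev_leq l d d' : (d <= d')%N -> (lev l d <= lev l d')%VS.
Proof.
have [c dim_d _] := levP l d; have [_ _ max] := levP l d'.
case: d => [|d] in c dim_d *; first by rewrite lev0 sub0v.
by move=> dd'; apply: max => //; apply: leq_ltn_trans dd'.
Qed.

Lemma chain_cut l d U : chain l U -> (U <= lev l d)%VS \/ (lev l d.+1 <= U)%VS.
Proof.
move=> cU; have [cd dim_d _] := levP l d.+1; have [_ _ max] := levP l d.
have [lt_d|le_d] := ltnP (\dim U) d; [left; exact: max | right].
have [Ud|//] := chain_total cU cd.
suff -> : lev l d.+1 = U by [].
by apply/esym/eqP; rewrite eqEdim Ud (leq_trans dim_d).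
Qed.

(* A step of the chain l is a pair (lev l d, lev l d.+1); it is indexed by the
   dimension of its upper end, all other indices giving degenerate steps. *)
Definition index : Type := 'I_(\dim {:M}).+1.
HB.instance Definition _ := Finite.on index.

Lemma lev_step_inj l (d d' : index) :
  lev l d.+1 = lev l d'.+1 -> ~~ (lev l d.+1 <= lev l d)%VS ->
  ~~ (lev l d'.+1 <= lev l d')%VS -> d = d'.
Proof.
wlog : d d' / (d <= d')%N.
  move=> IH e nd nd'; have [|/ltnW] := leqP d d'; first by move/IH; apply.
  by move/IH => /(_ (esym e) nd' nd).
rewrite leq_eqVlt => /orP[/eqP/val_inj//|lt_d] <- _ /negP[].
exact: lev_leq.
Qed.

(** Serves to recognize a step among images or preimages of the ends of another one; the index is
    [\dim H]. *)
Lemma lev_step_exists l L H : chain l L -> chain l H -> (L <= H)%VS ->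
    ~~ (H <= L)%VS ->
    (forall U, chain l U -> (U <= L)%VS \/ (H <= U)%VS) ->
  exists d : index, lev l d = L /\ lev l d.+1 = H.
Proof.
move=> cL cH LH HL cut.
have dimH : (\dim H < (\dim {:M}).+1)%N by rewrite ltnS dimvS ?subvf.
exists (Ordinal dimH) => /=; have [cd dim_d max_d] := levP l (\dim H).
have dimL : (\dim L < \dim H)%N.
  rewrite ltnNge; apply: contra HL => le_dim.
  by have /eqP -> : L == H by rewrite eqEdim LH.
have nH : ~~ (H <= lev l (\dim H))%VS.
  apply/negP => /dimvS/leq_trans/(_ dim_d); case: (\dim H) dimL => //= n _.
  by rewrite ltnn.
split; apply/eqP; rewrite eqEsubv.
  rewrite max_d // andbT; have [//|Hd] := cut _ cd.
  by rewrite Hd in nH.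
have [_ _ ->] := levP l (\dim H).+1; rewrite // andbT.
by have [Hd|//] := chain_cut (\dim H) cH; rewrite Hd in nH.
Qed.

(** Lifts a step through [phi], which may collapse subspaces, so [L'] and [H'] need not be
    consecutive. The first level whose image contains [H] and the level before it do the job. *)
Lemma lev_step_pullback l (phi : {vspace M} -> {vspace M}) L H L' H' :
    (forall U W, (U <= W)%VS -> (phi U <= phi W)%VS) ->
    (forall U, chain l U -> chain l (phi U)) ->
    (forall U, chain l U -> (U <= L)%VS \/ (H <= U)%VS) -> ~~ (H <= L)%VS ->
    chain l L' -> chain l H' -> L = phi L' -> H = phi H' ->
  exists d : index, phi (lev l d) = L /\ phi (lev l d.+1) = H.
Proof.
move=> phiS chain_phi cut HL cL' cH' eL eH.
have ex : exists d, (H <= phi (lev l d))%VS.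
  by exists (\dim {:M}).+1; rewrite lev_full eH phiS ?subvf.
case: (ex_minnP ex) => -[|d] Hd min_d.
  by case/negP: HL; rewrite eL (subv_trans Hd) // lev0 phiS ?sub0v.
have ltd : (d < (\dim {:M}).+1)%N.
  by apply: min_d; rewrite lev_full eH phiS ?subvf.
exists (Ordinal ltd) => /=.
have nd : ~~ (H <= phi (lev l d))%VS.
  by apply/negP => /min_d; rewrite ltnn.
have dL : (phi (lev l d) <= L)%VS.
  have [//|] := cut _ (chain_phi _ (chain_lev l d)).
  by rewrite (negPf nd).
split; apply/eqP; rewrite eqEsubv ?dL ?Hd ?andbT /=.
  have [/phiS|/phiS] := chain_cut d cL'; rewrite -eL // => dL'.
  by case/negP: HL; apply: subv_trans dL'.
have [/phiS|/phiS] := chain_cut d cH'; rewrite -eH // => dH.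
by case/negP: nd.
Qed.

(** A preimage under [other l] contains all images under [l], so inside the full image it equals
    that image. *)
Lemma chain_sub_img l U : chain l U -> (U <= img l fullv)%VS ->
  exists2 U', chain l U' & U = img l U'.
Proof.
case=> [_|sub|{}U cU _|{}U cU sub].
- by exists 0%VS; rewrite ?img0 //; apply: chain0.
- exists fullv; first exact: chainT.
  by apply/eqP; rewrite eqEsubv sub subvf.
- by exists U.
- exists fullv; first exact: chainT.
  by apply/eqP; rewrite eqEsubv sub img_sub_pre.
Qed.

Lemma chain_pre_sub l U : chain l U -> (pre (other l) 0 <= U)%VS ->
  exists2 U', chain l U' & U = pre (other l) U'.
Proof.
case=> [sub|_|{}U cU sub|{}U cU _].
- exists 0%VS; first exact: chain0.
  by apply/eqP; rewrite eqEsubv sub sub0v.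
- by exists fullv; rewrite ?preT //; apply: chainT.
- exists 0%VS; first exact: chain0.
  by apply/eqP; rewrite eqEsubv sub img_sub_pre.
- by exists U.
Qed.

(** * Pieces of the module and arrows between them *)

Definition idx (p : index * index) l := if l is LF then p.1 else p.2.

Implicit Types p q : (index * index)%type.

Definition Lo l p := lev l (idx p l).
Definition Hi l p := lev l (idx p l).+1.

Lemma LoHi l p : (Lo l p <= Hi l p)%VS.
Proof. exact: lev_leq. Qed.

(** [corner p] modulo [below p] is the piece at a pair of steps, the subquotient of the Zassenhaus
    butterfly lemma. *)
Definition corner p := (Hi LF p :&: Hi LV p)%VS.
Definition below p := (Lo LF p :&: Hi LV p + Lo LV p :&: Hi LF p)%VS.

Lemma mem_corner l p x :
  (x \in corner p) = (x \in Hi l p) && (x \in Hi (other l) p).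
Proof. by rewrite memv_cap; case: l => //=; rewrite andbC. Qed.

Lemma belowE l p :
  below p = (Lo l p :&: Hi (other l) p + Lo (other l) p :&: Hi l p)%VS.
Proof. by case: l => //; rewrite addvC. Qed.

Lemma belowP l p x : reflect
  (exists a b, [/\ x = a + b, a \in Lo l p, a \in Hi (other l) p,
                   b \in Lo (other l) p & b \in Hi l p])
  (x \in below p).
Proof.
rewrite (belowE l); apply: (iffP memv_addP) => [[a + [b + ->]]|].
  by rewrite !memv_cap => /andP[? ?] /andP[? ?]; exists a, b.
case=> a [b [-> aL aH bL bH]].
by exists a; [|exists b]; rewrite ?memv_cap ?aL ?bL.
Qed.

Lemma below_corner p : (below p <= corner p)%VS.
Proof.
apply/subvP => _ /(belowP LF)[a [b [-> aL aH bL bH]]].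
rewrite (mem_corner LF) !rpredD //.
  exact: subvP (LoHi _ _) _ bL.
exact: subvP (LoHi _ _) _ aL.
Qed.

Definition nondeg p := ~~ (corner p <= below p)%VS.

Lemma nondeg_step l p : nondeg p -> ~~ (Hi l p <= Lo l p)%VS.
Proof.
apply: contra => HL; apply/subvP => x; rewrite (mem_corner l) => /andP[xH xH'].
apply/(belowP l); exists x, 0; rewrite addr0 !mem0v; split=> //.
exact: subvP HL _ xH.
Qed.

Lemma idx_inj p q : (forall l, idx p l = idx q l) -> p = q.
Proof.
by case: p q => [a b] [c d] e; have /= -> := e LF; have /= -> := e LV.
Qed.

Lemma pair_of_idx l (d e : index) :
  exists p, idx p l = d /\ idx p (other l) = e.
Proof. by case: l; [exists (d, e) | exists (e, d)]. Qed.

(** [op l] carries the [l]-chain forward by images and the other chain backward by preimages. These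
    equations make it a bijection from the piece at [p] to the piece at [q]. *)
Definition arrow l p q :=
  [&& Lo l q == img l (Lo l p), Hi l q == img l (Hi l p),
      Lo (other l) p == pre l (Lo (other l) q)
    & Hi (other l) p == pre l (Hi (other l) q)].

Section Arrow.
Variables (l : letter) (p q : index * index).
Hypothesis pq : arrow l p q.

Lemma arrow_Lo : Lo l q = img l (Lo l p). Proof. by case/and4P: pq => /eqP. Qed.
Lemma arrow_Hi : Hi l q = img l (Hi l p). Proof. by case/and4P: pq => _ /eqP. Qed.
Lemma arrow_Lo_other : Lo (other l) p = pre l (Lo (other l) q).
Proof. by case/and4P: pq => _ _ /eqP. Qed.
Lemma arrow_Hi_other : Hi (other l) p = pre l (Hi (other l) q).
Proof. by case/and4P: pq => _ _ _ /eqP. Qed.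

Lemma op_corner x : x \in corner p -> op l x \in corner q.
Proof.
rewrite !(mem_corner l) arrow_Hi arrow_Hi_other mem_pre => /andP[xH ->].
by rewrite mem_img.
Qed.

Lemma op_below x : x \in below p -> op l x \in below q.
Proof.
case/(belowP l) => a [b [-> aL aH bL bH]]; apply/(belowP l).
exists (op l a), (op l b); rewrite linearD arrow_Lo arrow_Hi !mem_img //.
by split; rewrite // -mem_pre -?arrow_Hi_other -?arrow_Lo_other.
Qed.

Lemma op_corner_surj y :
  y \in corner q -> exists2 x, x \in corner p & y = op l x.
Proof.
rewrite (mem_corner l) arrow_Hi => /andP[/imgP[x xH ->] yH].
by exists x; rewrite // (mem_corner l) xH arrow_Hi_other mem_pre.
Qed.

(** Injectivity on pieces: the part of [op l x] in [Lo l q] lifts to [Lo l p], and the rest of [x]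
    maps into [Lo (other l) q]. *)
Lemma op_corner_below x : x \in corner p -> op l x \in below q -> x \in below p.
Proof.
rewrite (mem_corner l) => /andP[xH xH'] /(belowP l)[a [b [e aL aH bL bH]]].
move: aL; rewrite arrow_Lo => /imgP[a' a'L ea].
apply/(belowP l); exists a', (x - a').
rewrite addrC subrK; split=> //.
- by rewrite arrow_Hi_other mem_pre -ea.
- by rewrite arrow_Lo_other mem_pre linearB /= e ea addrC addKr.
- by rewrite rpredB //; apply: subvP (LoHi _ _) _ a'L.
Qed.

End Arrow.

Lemma Hi_cut l p U : chain l U -> (U <= Lo l p)%VS \/ (Hi l p <= U)%VS.
Proof. exact: chain_cut. Qed.

(** The [l]-step of [q] consists of images and is lifted through [img l]; the other step is pulled
    back by [pre l]. The piece at [p] is nonzero as it maps onto that at [q]. *)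
Lemma arrow_in_exists l q : nondeg q -> (Hi l q <= img l fullv)%VS ->
  exists2 p, nondeg p & arrow l p q.
Proof.
move=> nq Hq.
have Lq : (Lo l q <= img l fullv)%VS by apply: subv_trans Hq; apply: LoHi.
have [L' cL' eL] := chain_sub_img (chain_lev _ _) Lq.
have [H' cH' eH] := chain_sub_img (chain_lev _ _) Hq.
have [d [dL dH]] := lev_step_pullback (@imgS l) (@chain_img l)
  (@Hi_cut l q) (nondeg_step l nq) cL' cH' eL eH.
have cp U : chain (other l) U -> chain (other l) (pre l U).
  by move/chain_pre; rewrite otherK.
have : exists e : index, lev (other l) e = pre l (Lo (other l) q) /\
    lev (other l) e.+1 = pre l (Hi (other l) q).
  apply: lev_step_exists; try exact/cp/chain_lev.
  - exact/preS/LoHi.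
  (* Vectors of [corner q] are images under [l], so a collapse of the preimages would put them all
     in [Lo (other l) q]. *)
  - apply: contra nq => /subvP sub; apply/subvP => y.
    rewrite (mem_corner l) => /andP[yH yH'].
    have /imgP[x _ ey] := subvP Hq _ yH.
    apply/(belowP (other l)); exists y, 0.
    rewrite addr0 !mem0v otherK; split=> //.
    by have := sub x; rewrite !mem_pre -ey; apply.
  - move=> _ [||U cU|U cU].
    + by left; apply: sub0v.
    + by right; apply: subvf.
    + by left; rewrite -{2}[l]otherK; apply: img_sub_pre.
    + rewrite otherK; case: (Hi_cut q cU); first by left; apply: preS.
      by right; apply: preS.
case=> e [eL' eH']; have [p [pd pe]] := pair_of_idx l d e.
have pq : arrow l p q.
  by rewrite /arrow /Lo /Hi pd pe dL dH eL' eH' !eqxx.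
exists p => //; apply: contra nq => sub; apply/subvP => y.
by case/(op_corner_surj pq) => x /(subvP sub)/(op_below pq) + ->.
Qed.

(** Dual construction: the kernel of [op l] lies under the other step of [p], which therefore lifts
    through [pre l], while the [l]-step is pushed forward. *)
Lemma arrow_out_exists l p : nondeg p -> (pre l 0 <= Lo (other l) p)%VS ->
  exists2 q, nondeg q & arrow l p q.
Proof.
move=> np sub.
have sub' : (pre (other (other l)) 0 <= Lo (other l) p)%VS by rewrite otherK.
have [L' cL' eL] := chain_pre_sub (chain_lev _ _) sub'.
have [H' cH' eH] := chain_pre_sub (chain_lev _ _) (subv_trans sub' (LoHi _ _)).
have [d [dL dH]] := lev_step_pullback (@preS (other (other l)))
  (@chain_pre (other l)) (@Hi_cut (other l) p) (nondeg_step _ np)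
  cL' cH' eL eH.
rewrite otherK in dL dH.
have : exists e : index, lev l e = img l (Lo l p) /\
    lev l e.+1 = img l (Hi l p).
  apply: lev_step_exists; try exact/chain_img/chain_lev.
  - exact/imgS/LoHi.
  - apply: contra np => /subvP sub1; apply/subvP => x.
    rewrite (mem_corner l) => /andP[xH xH'].
    have /imgP[y yL exy] := sub1 _ (mem_img l xH).
    have xyL : x - y \in Lo (other l) p.
      by apply: (subvP sub); rewrite mem_pre linearB /= exy subrr mem0v.
    apply/(belowP l); exists y, (x - y).
    rewrite addrC subrK; split=> //.
      have -> : y = x - (x - y) by rewrite opprB addrC subrK.
      by rewrite rpredB //; apply: subvP (LoHi _ _) _ xyL.
    by rewrite rpredB //; apply: subvP (LoHi _ _) _ yL.
  - move=> _ [||U cU|U cU].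
    + by left; apply: sub0v.
    + by right; apply: subvf.
    + by case: (Hi_cut p cU); [left | right]; apply: imgS.
    + by right; apply: img_sub_pre.
case=> e [eL' eH']; have [q [qe qd]] := pair_of_idx l e d.
have pq : arrow l p q.
  by rewrite /arrow /Lo /Hi qd qe eL' eH' dL dH !eqxx.
exists q => //; apply: contra np => subq; apply/subvP => x xp.
by apply: (op_corner_below pq) => //; apply: (subvP subq); apply: op_corner xp.
Qed.

Lemma arrow_tail_eq l p p' q : nondeg p -> nondeg p' -> nondeg q ->
  arrow l p q -> arrow l p' q -> p = p'.
Proof.
move=> np np' nq pq p'q.
have Ho : idx p (other l) = idx p' (other l).
  apply: (@lev_step_inj (other l)); try exact: nondeg_step.
  by rewrite -!/(Hi _ _) (arrow_Hi_other pq) (arrow_Hi_other p'q).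
have le r r' : arrow l r q -> arrow l r' q -> (idx r l <= idx r' l)%N.
  move=> rq r'q; rewrite leqNgt; apply: contra (nondeg_step l nq) => lt_r.
  rewrite (arrow_Hi r'q) (arrow_Lo rq); apply: imgS.
  exact: lev_leq.
have Hl : idx p l = idx p' l by apply/val_inj/anti_leq; rewrite !le.
by apply: idx_inj; case: l Ho Hl {pq p'q le} => ? ? [].
Qed.

Lemma arrow_head_eq l p q q' : nondeg p -> nondeg q -> nondeg q' ->
  arrow l p q -> arrow l p q' -> q = q'.
Proof.
move=> np nq nq' pq pq'.
have Hl : idx q l = idx q' l.
  apply: (@lev_step_inj l); try exact: nondeg_step.
  by rewrite -!/(Hi _ _) (arrow_Hi pq) (arrow_Hi pq').
have le r r' : arrow l p r -> arrow l p r' ->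
    (idx r (other l) <= idx r' (other l))%N.
  move=> pr pr'; rewrite leqNgt; apply: contra (nondeg_step (other l) np) => lt.
  rewrite (arrow_Hi_other pr') (arrow_Lo_other pr); apply: preS.
  exact: lev_leq.
have Ho : idx q (other l) = idx q' (other l).
  by apply/val_inj/anti_leq; rewrite !le.
by apply: idx_inj; case: l Ho Hl {pq pq' le} => ? ? [].
Qed.

Lemma arrow_alternate l p q r :
  nondeg q -> arrow l p q -> ~~ arrow (other l) q r.
Proof.
move=> nq pq; apply: contra (nondeg_step l nq) => qr.
rewrite (arrow_Hi pq); have := arrow_Lo_other qr; rewrite otherK => ->.
exact: img_sub_pre.
Qed.

Definition chain_vertex : finType := {p : index * index | nondeg p}.

Definition chain_quiver : quiver :=
  @LGraph letter chain_vertex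
    [set e : chain_vertex * chain_vertex * letter |
      arrow e.2 (val e.1.1) (val e.1.2)].

Lemma chain_quiver_arrow (u v : chain_quiver) l :
  ((u, v, l) \in arrows chain_quiver) = arrow l (val u) (val v).
Proof. by rewrite inE. Qed.

Lemma kraft_chain_quiver : kraft chain_quiver.
Proof.
apply: kraftI => [u u' v l|u v v' l|u v w l]; rewrite !chain_quiver_arrow.
- by move=> uv u'v; apply/val_inj; apply: arrow_tail_eq uv u'v; apply: valP.
- by move=> uv uv'; apply/val_inj; apply: arrow_head_eq uv uv'; apply: valP.
- by move=> uv; apply: arrow_alternate uv; apply: valP.
Qed.

(** The kernel of [op l] belongs to the other chain: it lies either under the other step of [u],
    which produces an arrow, or above it. *)
Lemma no_arrow_out l (u : chain_quiver) x :
  (forall v : chain_quiver, (u, v, l) \notin arrows chain_quiver) ->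
  x \in Hi (other l) (val u) -> op l x = 0.
Proof.
move=> no xH.
have c0 : chain (other l) (pre l 0).
  by have := chain_pre (chain0 (other l)); rewrite otherK.
have [sub|sub] := Hi_cut (val u) c0.
  have [q nq uq] := arrow_out_exists (valP u) sub.
  by have := no (Sub q nq); rewrite chain_quiver_arrow uq.
by have := subvP sub _ xH; rewrite mem_pre memv0 => /eqP.
Qed.

Lemma arrow_in l (v : chain_quiver) : (Hi l (val v) <= img l fullv)%VS ->
  exists u : chain_quiver, (u, v, l) \in arrows chain_quiver.
Proof.
case/(arrow_in_exists (valP v)) => p np pv.
by exists (Sub p np); rewrite chain_quiver_arrow.
Qed.

Lemma Hi_img l (u v : chain_quiver) U : (u, v, l) \in arrows chain_quiver ->
  chain l U -> (Hi l (val v) <= img l U)%VS = (Hi l (val u) <= U)%VS.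
Proof.
rewrite chain_quiver_arrow => uv cU; apply/idP/idP => [|sub]; last first.
  by rewrite (arrow_Hi uv) imgS.
have [/(imgS l)|//] := Hi_cut (val u) cU.
rewrite -(arrow_Lo uv) => UL HU; case/negP: (nondeg_step l (valP v)).
exact: subv_trans UL.
Qed.

Lemma Hi_pre l (u v : chain_quiver) U : (u, v, l) \in arrows chain_quiver ->
  chain (other l) U ->
  (Hi (other l) (val u) <= pre l U)%VS = (Hi (other l) (val v) <= U)%VS.
Proof.
rewrite chain_quiver_arrow => uv cU; apply/idP/idP => [|sub]; last first.
  by rewrite (arrow_Hi_other uv) preS.
have [/(preS l)|//] := Hi_cut (val v) cU.
rewrite -(arrow_Lo_other uv) => UL HU.
case/negP: (nondeg_step (other l) (valP u)).
exact: subv_trans UL.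
Qed.

(** Translates chain members into words, so that the type of a vertex determines the upper ends of
    its two steps. *)
Lemma chain_word l U : chain l U -> exists e w,
  forall v : chain_quiver, word_set e w v = (Hi l (val v) <= U)%VS.
Proof.
elim=> [||{}U cU [e [w IH]]|{}U cU [e [w IH]]].
- exists false, [::] => v /=; apply/esym/negP => sub.
  case/negP: (nondeg_step l (valP v)); apply: subv_trans sub _.
  exact: sub0v.
- by exists true, [::] => v /=; rewrite subvf.
- exists e, ((true, l) :: w) => v /=; apply/existsP/idP.
    by case=> u /andP[uv]; rewrite IH (Hi_img uv).
  move=> sub; have [|u uv] := @arrow_in l v.
    by apply: subv_trans sub _; apply/imgS/subvf.
  by exists u; rewrite uv IH -(Hi_img uv).
- exists e, ((false, other l) :: w) => v /=.
  have cU' : chain (other (other l)) U by rewrite otherK.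
  have [/existsP[u vu]|/existsPn no] :=
      boolP [exists u, (v, u, other l) \in arrows chain_quiver].
    have := word_set_preimage kraft_chain_quiver vu e w => /= ->.
    by have := Hi_pre vu cU'; rewrite !otherK => ->.
  have -> : (Hi l (val v) <= pre (other l) U)%VS.
    apply/subvP => x; rewrite -{1}[l]otherK mem_pre => /(no_arrow_out no)->.
    exact: mem0v.
  by apply/forallP => u; rewrite (negPf (no u)).
Qed.

Lemma separated_chain_quiver : separated chain_quiver.
Proof.
move=> u v uv; apply/val_inj/idx_inj => l.
have sub U : chain l U -> (Hi l (val u) <= U)%VS = (Hi l (val v) <= U)%VS.
  by case/chain_word=> e [w wE]; rewrite -!wE uv.
apply: (@lev_step_inj l); try exact/nondeg_step/valP.
apply/eqP; rewrite eqEsubv; have cl := chain_lev l.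
by apply/andP; split; [rewrite sub|rewrite -sub].
Qed.

(** * Splitting *)

(* The part of Lo l v that dies after n steps backwards along the quiver. *)
Fixpoint depth l n (v : chain_quiver) : {vspace M} :=
  if n is n'.+1 then
    if [pick u | (u, v, l) \in arrows chain_quiver] is Some u
    then img l (depth l n' u)
    else if [pick u | (v, u, other l) \in arrows chain_quiver] is Some u
    then pre (other l) (depth l n' u)
    else Lo l (val v)
  else 0%VS.

Variant depth_spec l n (v : chain_quiver) : {vspace M} -> Prop :=
  | DepthIn u of (u, v, l) \in arrows chain_quiver :
      depth_spec l n v (img l (depth l n u))
  | DepthOut u of (v, u, other l) \in arrows chain_quiver :
      depth_spec l n v (pre (other l) (depth l n u))
  | DepthEnd of (forall u, (v, u, other l) \notin arrows chain_quiver) :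
      depth_spec l n v (Lo l (val v)).

Lemma depthP l n v : depth_spec l n v (depth l n.+1 v).
Proof.
rewrite /=; case: pickP => [u uv|_]; first exact: DepthIn.
case: pickP => [u vu|no]; first exact: DepthOut.
by apply: DepthEnd => u; rewrite no.
Qed.

Lemma depth_in l n (u v : chain_quiver) :
  (u, v, l) \in arrows chain_quiver -> depth l n.+1 v = img l (depth l n u).
Proof.
move=> uv /=; case: pickP => [u' u'v|/(_ u)]; last by rewrite uv.
by rewrite (kraft_tail_eq kraft_chain_quiver u'v uv).
Qed.

Lemma depth_out l n (u v : chain_quiver) : (u, v, l) \in arrows chain_quiver ->
  depth (other l) n.+1 u = pre l (depth (other l) n v).
Proof.
move=> uv; have nou w : ((w, u, other l) \in arrows chain_quiver) = false.
  apply/negP => wu; case/negP: (kraft_alternate kraft_chain_quiver v wu).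
  by rewrite otherK.
rewrite /=; case: pickP => [w|_]; first by rewrite nou.
rewrite otherK; case: pickP => [v' uv'|/(_ v)]; last by rewrite uv.
by rewrite (kraft_head_eq kraft_chain_quiver uv' uv).
Qed.

Lemma depth_Lo l n v : (depth l n v <= Lo l (val v))%VS.
Proof.
elim: n v => [|n IH] v; first exact: sub0v.
case: depthP => // u uv; rewrite chain_quiver_arrow in uv.
  by rewrite (arrow_Lo uv) imgS.
by have := arrow_Lo_other uv; rewrite otherK => ->; apply: preS.
Qed.

Lemma depth_leq l m n v : (m <= n)%N -> (depth l m v <= depth l n v)%VS.
Proof.
elim: m n v => [|m IH] [|n] v //; try by rewrite sub0v.
rewrite ltnS => le_mn; case: (depthP l n v) => [u uv|u vu|no].
- by rewrite (depth_in m uv) imgS ?IH.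
- have := depth_out m vu; rewrite otherK => ->; exact/preS/IH.
- exact: depth_Lo.
Qed.

(** Each image or preimage in the construction of [U] costs one step along the quiver, so the length
    of the construction bounds the depth. *)
Lemma depth_chain l U : chain l U -> exists n, forall v : chain_quiver,
  (U <= Lo l (val v))%VS -> (U <= depth l n v)%VS.
Proof.
have no_full (v : chain_quiver) : ~~ (fullv <= Lo l (val v))%VS.
  apply: contra (nondeg_step l (valP v)); exact/subv_trans/subvf.
elim=> [||{}U cU [n IH]|{}U cU [n IH]].
- by exists 0%N => v _; apply: sub0v.
- by exists 0%N => v; rewrite (negPf (no_full v)).
- exists n.+1 => v Uv; case: depthP => [u uv|u vu|//].
    apply/imgS/IH; have [//|Hu] := Hi_cut (val u) cU.
    rewrite -(Hi_img uv cU) in Hu.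
    by case/negP: (nondeg_step l (valP v)); apply: subv_trans Uv.
  exact: img_sub_pre.
- exists n.+1 => v Uv; case: depthP => [u uv|u vu|//].
    rewrite chain_quiver_arrow in uv.
    case/negP: (nondeg_step l (valP v)); apply: subv_trans Uv.
    by rewrite (arrow_Hi uv) img_sub_pre.
  apply/preS/IH; have [//|Hu] := Hi_cut (val u) cU.
  have cU' : chain (other (other l)) U by rewrite otherK.
  have := Hi_pre vu cU'; rewrite otherK Hu => HU.
  by case/negP: (nondeg_step l (valP v)); apply: subv_trans Uv.
Qed.

(** [Lo l (val v)] is itself a chain member and the vertices are finitely many; this bound makes the
    corrections below terminate. *)
Lemma depth_full : exists n, forall l v, (Lo l (val v) <= depth l n v)%VS.
Proof.
have ex (i : letter * chain_quiver) :
    exists n, (Lo i.1 (val i.2) <= depth i.1 n i.2)%VS.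
  have [n nP] := depth_chain (chain_lev i.1 (idx (val i.2) i.1)).
  by exists n; apply: nP.
have [n nP] := fin_all_exists ex.
exists (\max_i n i)%N => l v; apply: subv_trans (nP (l, v)) _.
exact/depth_leq/(leq_bigmax (l, v)).
Qed.

(** For large [n] the zones for [l] and [other l] are the two summands of [below (val v)]. *)
Definition zone l n (v : chain_quiver) :=
  (depth l n v :&: Hi (other l) (val v))%VS.

Lemma zone0 l v : zone l 0 v = 0%VS.
Proof. exact: cap0v. Qed.

Lemma zone_leq l m n v : (m <= n)%N -> (zone l m v <= zone l n v)%VS.
Proof. by move=> mn; apply/capvS; rewrite ?depth_leq. Qed.

Lemma zone_below l n v : (zone l n v <= below (val v))%VS.
Proof.
by rewrite (belowE l); apply: subv_trans (addvSl _ _); rewrite capvS ?depth_Lo.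
Qed.

(** Along an [l]-arrow the [l]-zone is pulled back and, in the next lemma, the other zone pushed
    forward; the depth drops by one each time. *)
Lemma zone_img l n (u v : chain_quiver) x :
  (u, v, l) \in arrows chain_quiver -> x \in zone l n.+1 v ->
  exists2 y, y \in zone l n u & x = op l y.
Proof.
move=> uv; rewrite memv_cap (depth_in n uv) => /andP[/imgP[y yd ->] yH].
exists y => //; rewrite memv_cap yd.
by rewrite chain_quiver_arrow in uv; rewrite (arrow_Hi_other uv) mem_pre.
Qed.

Lemma zone_pre l n (u v : chain_quiver) x :
  (u, v, l) \in arrows chain_quiver -> x \in zone (other l) n.+1 u ->
  op l x \in zone (other l) n v.
Proof.
move=> uv; rewrite !memv_cap (depth_out n uv) mem_pre otherK => /andP[->].
by rewrite chain_quiver_arrow in uv; rewrite (arrow_Hi uv); apply: mem_img.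
Qed.

(** * The graded representation, on complements of [below] in [corner] *)

Definition layer (v : chain_quiver) := (corner (val v) :\: below (val v))%VS.

Definition layer_proj (v : chain_quiver) : 'Hom(M, subvs_of (layer v)) :=
  linfun (vsproj (layer v) \o daddv_pi (layer v) (below (val v))).

Lemma layer_corner v (w : subvs_of (layer v)) : vsval w \in corner (val v).
Proof. by apply: subvP (diffvSl _ _) _ _; apply: subvsP. Qed.

Lemma layer_projK v (w : subvs_of (layer v)) : layer_proj v (vsval w) = w.
Proof.
by rewrite lfunE /= daddv_pi_id ?vsvalK ?capv_diff ?subvsP.
Qed.

Lemma layer_proj_below v x : x \in below (val v) -> layer_proj v x = 0.
Proof.
move=> xb; rewrite lfunE /=; suff -> : daddv_pi (layer v) (below (val v)) x = 0.
  exact: linear0.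
have d := capv_diff (corner (val v)) (below (val v)).
have xs : x \in (layer v + below (val v))%VS.
  exact: subvP (addvSr _ _) _ xb.
have := daddv_pi_add d xs; rewrite (@daddv_pi_id _ _ (below _)) 1?capvC //.
by move/(canRL (addrK _)); rewrite subrr.
Qed.

Lemma layer_proj_corner v x :
  x \in corner (val v) -> x - vsval (layer_proj v x) \in below (val v).
Proof.
move=> xc; have d := capv_diff (corner (val v)) (below (val v)).
have xs : x \in (layer v + below (val v))%VS.
  by rewrite addv_diff; apply: subvP (addvSl _ _) _ xc.
rewrite lfunE /= vsprojK ?memv_pi // -{1}(daddv_pi_add d xs) addrC addKr.
exact: memv_pi.
Qed.

Lemma layer_below v (w : subvs_of (layer v)) :
  vsval w \in below (val v) -> w = 0.
Proof. by move/layer_proj_below; rewrite layer_projK. Qed.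

Definition layer_map l u v (w : subvs_of (layer u)) : subvs_of (layer v) :=
  layer_proj v (op l (vsval w)).

Fact layer_map_linear l u v :
  linear_for (twist sigma tau l \; *:%R) (@layer_map l u v).
Proof. by move=> a x y; rewrite /layer_map !linearP. Qed.

HB.instance Definition _ l u v := GRing.isLinear.Build K _ _ _ _
  (@layer_map_linear l u v).

Lemma layer_map_bij l (u v : chain_quiver) :
  (u, v, l) \in arrows chain_quiver -> bijective (@layer_map l u v).
Proof.
rewrite chain_quiver_arrow => uv.
have inj : injective (@layer_map l u v).
  apply: raddf_inj => w w0; apply: layer_below.
  apply: (op_corner_below uv); first exact: layer_corner.
  have := layer_proj_corner (op_corner uv (layer_corner w)).
  by rewrite -/(layer_map l v w) w0 /= subr0.
have surj (y : subvs_of (layer v)) : exists w, @layer_map l u v w == y.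
  have [x xc ex] := op_corner_surj uv (layer_corner y).
  exists (layer_proj u x); apply/eqP; rewrite -[RHS]layer_projK ex.
  apply/eqP; rewrite -subr_eq0 /layer_map -linearB; apply/eqP.
  apply: layer_proj_below; rewrite -linearB; apply: (op_below uv).
  by rewrite -opprB rpredN; apply: layer_proj_corner.
exists (fun w => xchoose (surj w)) => [x|y].
  by apply: inj; apply/eqP; apply: (xchooseP (surj _)).
by apply/eqP; apply: (xchooseP (surj _)).
Qed.

Definition chain_repr : representation sigma tau chain_quiver :=
  @Representation K sigma tau chain_quiver (fun v => subvs_of (layer v))
    layer_map.

Lemma strict_chain_repr : strict chain_repr.
Proof. by move=> u v l; apply: layer_map_bij. Qed.

Lemma nowhere_zero_chain_repr : nowhere_zero chain_repr.
Proof.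
move=> v; rewrite lt0n dimv_eq0; apply: contra (valP v) => /eqP zero.
apply/subvP => x /layer_proj_corner; set w := layer_proj v x.
have : w \in {: subvs_of (layer v)}%VS by apply: memvf.
by rewrite zero memv0 => /eqP->; rewrite /= subr0.
Qed.

(** The lift is chosen on a basis and extended linearly; since [e] and [op l] have the same twist,
    it lifts [e] everywhere. *)
Lemma linear_lift (T : vectType K) l (e : T -> M) (Z : {vspace M}) :
    (forall a t t', e (a *: t + t') = twist sigma tau l a *: e t + e t') ->
    (forall t, exists2 z, z \in Z & e t = op l z) ->
  exists p : 'Hom(T, M), forall t, p t \in Z /\ op l (p t) = e t.
Proof.
move=> elin eZ; pose b := vbasis {:T}.
have /fin_all_exists2[z zZ zE] : forall i : 'I_(\dim {:T}),
    exists2 z, z \in Z & e b`_i = op l z by move=> i; apply: eZ.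
pose p t := \sum_i coord b i t *: z i.
have plin : linear p.
  move=> a x y; rewrite /p scaler_sumr -big_split; apply: eq_bigr => i _ /=.
  by rewrite linearP scalerDl scalerA.
pose pL : {linear T -> M} := HB.pack p (GRing.isLinear.Build K _ _ _ p plin).
exists (linfun pL) => x; rewrite lfunE /= /p; split.
  by apply: rpred_sum => i _; apply: rpredZ.
have e0 : e 0 = 0.
  have := elin 1 0 0; rewrite scaler0 addr0 rmorph1 scale1r => /esym/eqP.
  by rewrite -subr_eq0 addrK => /eqP.
have esum (c : 'I_(\dim {:T}) -> K) : e (\sum_i c i *: b`_i) =
    \sum_i twist sigma tau l (c i) *: e b`_i.
  elim/big_rec2: _ => [|i y1 y2 _ <-]; [exact: e0 | exact: elin].
rewrite [in RHS](coord_vbasis (memvf x)) esum linear_sum; apply: eq_bigr => i _.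
by rewrite linearZ /= -zE.
Qed.

Lemma linear_factor (T T' : vectType K) l
    (rho : {linear T -> T' | twist sigma tau l \; *:%R}) (e : T -> M) :
    bijective rho ->
    (forall a t t', e (a *: t + t') = twist sigma tau l a *: e t + e t') ->
  exists q : 'Hom(T', M), forall t, q (rho t) = e t.
Proof.
case=> rho' rhoK rhoK' elin; have [s _ sK] := twist_bij l.
have qlin : linear (e \o rho').
  move=> a x y /=; rewrite -[in RHS](sK a) -elin; congr e.
  by rewrite -[LHS]rhoK; apply: (canLR rhoK); rewrite linearP /= sK !rhoK'.
pose q : {linear T' -> M} :=
  HB.pack (e \o rho') (GRing.isLinear.Build K _ _ _ _ qlin).
by exists (linfun q) => x; rewrite lfunE /= rhoK.
Qed.

(** * Lifts of the layers and their errors *)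

Definition lifting := forall v : chain_quiver, 'Hom(subvs_of (layer v), M).

Implicit Type s : lifting.

Definition lifts s :=
  forall v (w : subvs_of (layer v)), s v w - vsval w \in below (val v).

Definition err s l u v (w : subvs_of (layer u)) :=
  op l (s u w) - s v (layer_map l v w).

Lemma err_linear s l u v a (x y : subvs_of (layer u)) :
  err s l v (a *: x + y) = twist sigma tau l a *: err s l v x + err s l v y.
Proof.
by rewrite /err !linearP /= scalerBr scalerN addrACA.
Qed.

Definition near_repr m n s := forall u v l, (u, v, l) \in arrows chain_quiver ->
  forall w, err s l v (w : subvs_of (layer u)) \in
    (zone l m v + zone (other l) n v)%VS.

(* The component of the error along other l is absorbed by changing s at the
   head of each arrow labelled l; the change reappears one step further. *)
Lemma correct_heads n s : lifts s -> near_repr n.+1 n.+1 s ->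
  exists2 s', lifts s' & near_repr n.+1 n s'.
Proof.
move=> ls ns.
have ex (i : chain_quiver * letter) :
    exists q : 'Hom(subvs_of (layer i.1), M),
    [/\ forall w, q w \in zone (other i.2) n.+1 i.1,
        forall u, (u, i.1, i.2) \in arrows chain_quiver -> forall w,
          err s i.2 i.1 (w : subvs_of (layer u)) - q (layer_map i.2 i.1 w)
            \in zone i.2 n.+1 i.1
      & (forall u, (u, i.1, i.2) \notin arrows chain_quiver) -> q = 0].
  case: i => v l /=; have [/existsP[u uv]|/existsPn no] :=
      boolP [exists u, (u, v, l) \in arrows chain_quiver]; last first.
    exists 0; split=> // [w|u]; first by rewrite zero_lfunE mem0v.
    by rewrite (negPf (no u)).
  pose e (w : subvs_of (layer u)) :=
    addv_pi2 (zone l n.+1 v) (zone (other l) n.+1 v) (err s l v w).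
  have elin a t t' : e (a *: t + t') = twist sigma tau l a *: e t + e t'.
    by rewrite /e err_linear linearP.
  have [q qE] := linear_factor (layer_map_bij uv) elin.
  have [r _ rK] := layer_map_bij uv.
  exists q; split=> [w|u' u'v|/(_ u)]; last by rewrite uv.
    by rewrite -(rK w) qE memv_pi2.
  rewrite (kraft_tail_eq kraft_chain_quiver u'v uv) => w.
  by rewrite qE -{1}(addv_pi1_pi2 (ns _ _ _ uv w)) addrK memv_pi1.
have {ex} /fin_all_exists[q qP] := ex.
pose s' : lifting := fun v => s v + q (v, LF) + q (v, LV).
have s'E l v w : s' v w = s v w + q (v, l) w + q (v, other l) w.
  by rewrite /s' !add_lfunE; case: l => //=; rewrite addrAC.
exists s' => [v w|u v l uv w].
  rewrite (s'E LF) addrAC [X in X + _]addrAC.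
  have [qF _ _] := qP (v, LF); have [qV _ _] := qP (v, LV).
  apply: rpredD; [apply: rpredD; [exact: ls|] |].
    exact: subvP (zone_below _ _ _) _ (qF w).
  exact: subvP (zone_below _ _ _) _ (qV w).
have [qvl qve _] := qP (v, l); have [qul _ _] := qP (u, l).
have [qvo _ _] := qP (v, other l); have [_ _ quo] := qP (u, other l).
(* An [l]-arrow leaves [u], so no [other l]-arrow enters it, and the lift at [u] changes only by
   [q (u, l)]. *)
have quo0 : q (u, other l) = 0.
  apply: quo => x; apply/negP => xu.
  by have := kraft_alternate kraft_chain_quiver v xu; rewrite otherK uv.
rewrite /err !(s'E l) quo0 zero_lfunE addr0 linearD /=.
set w' := layer_map l v w.
(* The bracket lies in the [l]-zone, as [q (v, other l)] was chosen for the opposite label; the last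
   term has depth [n] after its push along the arrow. *)
have -> : op l (s u w) + op l (q (u, l) w) -
    (s v w' + q (v, l) w' + q (v, other l) w') =
    (err s l v w - q (v, l) w' - q (v, other l) w') + op l (q (u, l) w).
  by rewrite /err -/w' addrAC !opprD !addrA.
apply: memv_add; last exact: zone_pre uv (qul w).
apply: rpredB; first exact: qve.
by have := qvo w'; rewrite /= otherK.
Qed.

(* The component of the error along l is absorbed by changing s at the tail of
   each arrow labelled l. *)
Lemma correct_tails n s : lifts s -> near_repr n.+1 n s ->
  exists2 s', lifts s' & near_repr n n s'.
Proof.
move=> ls ns.
have ex (i : chain_quiver * letter) :
    exists p : 'Hom(subvs_of (layer i.1), M),
    [/\ forall w, p w \in zone i.2 n i.1,
        forall v, (i.1, v, i.2) \in arrows chain_quiver -> forall w,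
          err s i.2 v w - op i.2 (p w) \in zone (other i.2) n v
      & (forall v, (i.1, v, i.2) \notin arrows chain_quiver) -> p = 0].
  case: i => u l /=; have [/existsP[v uv]|/existsPn no] :=
      boolP [exists v, (u, v, l) \in arrows chain_quiver]; last first.
    exists 0; split=> // [w|v]; first by rewrite zero_lfunE mem0v.
    by rewrite (negPf (no v)).
  pose e (w : subvs_of (layer u)) :=
    addv_pi1 (zone l n.+1 v) (zone (other l) n v) (err s l v w).
  have elin a t t' : e (a *: t + t') = twist sigma tau l a *: e t + e t'.
    by rewrite /e err_linear linearP.
  have [w|p pP] := @linear_lift _ l e (zone l n u) elin.
    exact: zone_img uv (memv_pi1 _ _ _).
  exists p; split=> [w|v' uv'|/(_ v)]; last by rewrite uv.
    by case: (pP w).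
  rewrite (kraft_head_eq kraft_chain_quiver uv' uv) => w.
  have [_ ->] := pP w.
  by rewrite -{1}(addv_pi1_pi2 (ns _ _ _ uv w)) addrC addKr memv_pi2.
have {ex} /fin_all_exists[p pP] := ex.
pose s' : lifting := fun v => s v - p (v, LF) - p (v, LV).
have s'E l v w : s' v w = s v w - p (v, l) w - p (v, other l) w.
  by rewrite /s' !(add_lfunE, opp_lfunE); case: l => //=; rewrite addrAC.
exists s' => [v w|u v l uv w].
  rewrite (s'E LF) addrAC [X in X + _]addrAC.
  have [pF _ _] := pP (v, LF); have [pV _ _] := pP (v, LV).
  apply: rpredB; [apply: rpredB; [exact: ls|] |].
    exact: subvP (zone_below _ _ _) _ (pF w).
  exact: subvP (zone_below _ _ _) _ (pV w).
have [pul pue _] := pP (u, l); have [pvl _ _] := pP (v, l).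
have [puo _ _] := pP (u, other l); have [_ _ pvo] := pP (v, other l).
have pvo0 : p (v, other l) = 0.
  by apply: pvo => x; apply: (kraft_alternate kraft_chain_quiver x uv).
rewrite /err !(s'E l) pvo0 zero_lfunE subr0 2!linearB /=.
set w' := layer_map l v w.
(* [p (v, l)] contributes to the [l]-zone only at depth [n]; the rest lies in the other zone at
   depth [n]. *)
have -> : op l (s u w) - op l (p (u, l) w) - op l (p (u, other l) w) -
    (s v w' - p (v, l) w') = p (v, l) w' +
    ((err s l v w - op l (p (u, l) w)) - op l (p (u, other l) w)).
  rewrite /err -/w' opprB [RHS]addrC [p (v, l) w' - _]addrC addrA.
  by congr (_ + _); rewrite addrAC [X in X - _]addrAC.
apply: memv_add; first exact: pvl.
apply: rpredB; first exact: pue.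
by apply: (zone_pre uv); apply: subvP (zone_leq _ _ (leqnSn n)) _ (puo w).
Qed.

Lemma splitting_exists : exists2 s, lifts s &
  forall u v l, (u, v, l) \in arrows chain_quiver ->
  forall w : subvs_of (layer u), op l (s u w) = s v (layer_map l v w).
Proof.
suff [s ls ns] : exists2 s, lifts s & near_repr 0 0 s.
  exists s => // u v l uv w; apply/eqP; rewrite -subr_eq0 -memv0.
  by have := ns u v l uv w; rewrite !zone0 addv0.
have [n full] := depth_full.
have [s ls ns] : exists2 s, lifts s & near_repr n n s.
  (* The errors of the plain inclusions lie in [below], the sum of the two zones at full depth. *)
  pose s : lifting := fun v => linfun vsval.
  exists s => [v w|u v l uv w]; first by rewrite lfunE subrr mem0v.
  rewrite /err !lfunE /=; rewrite chain_quiver_arrow in uv.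
  have := layer_proj_corner (op_corner uv (layer_corner w)).
  apply: subvP; rewrite (belowE l); apply: addvS.
    exact: capvS (full _ _) (subvv _).
  by rewrite /zone otherK; apply: capvS (full _ _) (subvv _).
elim: n {full} s ls ns => [|n IH] s ls ns; first by exists s.
have [s1 ls1 ns1] := correct_heads ls ns.
by have [s2 ls2 /IH] := correct_tails ls1 ns1; apply.
Qed.

(** * The module as the sum of the lifted layers *)

Section Assembly.
Variable s : lifting.
Hypotheses (ls : lifts s) (s_op : forall u v l,
  (u, v, l) \in arrows chain_quiver ->
  forall w : subvs_of (layer u), op l (s u w) = s v (layer_map l v w)).

Let T := dirsum (repr_space chain_repr).

Definition assemble (x : T) : M := \sum_v s v (x v).

Fact assemble_linear : linear assemble.
Proof.
move=> a x y; rewrite /assemble scaler_sumr -big_split; apply: eq_bigr => v _.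
by rewrite dirsumDE dirsumZE linearP.
Qed.

HB.instance Definition _ := GRing.isLinear.Build K T M _ _ assemble_linear.

Lemma lift_corner v w : s v w \in corner (val v).
Proof.
rewrite -[s v w](subrK (vsval w)) rpredD ?layer_corner //.
exact: subvP (below_corner _) _ (ls _).
Qed.

Lemma assemble_op l (x : T) : assemble (attached_map chain_repr l x) =
  op l (assemble x).
Proof.
rewrite /assemble linear_sum.
transitivity (\sum_v \sum_(u | (u, v, l) \in arrows chain_quiver)
    op l (s u (x u))).
  apply: eq_bigr => v _; rewrite ffunE linear_sum; apply: eq_bigr => u uv.
  by rewrite (s_op uv).
rewrite (exchange_big_dep predT) //=; apply: eq_bigr => u _.
have [/existsP[v uv]|/existsPn no] :=
    boolP [exists v, (u, v, l) \in arrows chain_quiver].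
  rewrite (bigD1 v) //= big1 ?addr0 // => v' /andP[uv'].
  by rewrite (kraft_head_eq kraft_chain_quiver uv uv') eqxx.
rewrite big1 => [|v uv]; last by rewrite (negPf (no v)) in uv.
rewrite (no_arrow_out no) //.
by have := lift_corner (x u); rewrite (mem_corner l) => /andP[].
Qed.

(** Consider the nonzero coordinate at the lexicographically largest pair: the other coordinates
    force its lift into [below], so it vanishes. *)
Lemma assemble_inj : injective assemble.
Proof.
apply: raddf_inj => x x0; apply/ffunP => v0; rewrite dirsum0E.
apply/eqP; apply: contraT => nz0.
(* The second index is at most [\dim {:M}], so this weight encodes the lexicographic order. *)
pose wt (v : chain_quiver) : nat :=
  ((val v).1 * (\dim {:M}).+1 + (val v).2)%N.
have [v nz max_v] := @arg_maxnP _ v0 (fun v => x v != 0) wt nz0.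
have sumE : s v (x v) = - \sum_(u | u != v) s u (x u).
  apply/eqP; rewrite -addr_eq0; have: \sum_v s v (x v) == 0 by apply/eqP.
  by rewrite (bigD1 v).
have lower : s v (x v) \in (Lo LF (val v) + Lo LV (val v) :&: Hi LF (val v))%VS.
  rewrite sumE rpredN; apply: rpred_sum => u uv.
  have [->|nzu] := eqVneq (x u) 0; first by rewrite linear0 mem0v.
  have := lift_corner (x u); rewrite (mem_corner LF) /= => /andP[uF uV].
  have := max_v u nzu; rewrite /wt /= => le_wt.
  have [lt_u|le_u] := ltnP (val u).1 (val v).1.
    by apply: subvP (addvSl _ _) _ _; apply: subvP (lev_leq _ lt_u) _ uF.
  have e1 : (val u).1 = (val v).1.
    apply/val_inj/anti_leq; rewrite le_u andbT -ltnS.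
    rewrite -(@ltn_pmul2r (\dim {:M}).+1) // mulSn.
    apply: leq_ltn_trans (leq_addr _ _) (leq_ltn_trans le_wt _).
    by rewrite addnC ltn_add2r.
  have lt2 : ((val u).2 < (val v).2)%N.
    rewrite e1 leq_add2l in le_wt.
    rewrite ltn_neqAle le_wt andbT; apply: contraNneq uv => e2.
    by apply/eqP/val_inj/idx_inj => -[] //=; apply: val_inj.
  apply: subvP (addvSr _ _) _ _; rewrite memv_cap.
  rewrite (subvP (lev_leq _ lt2) _ uV) /=.
  by move: uF; rewrite /Hi /= e1.
have sb : s v (x v) \in below (val v).
  case/memv_addP: lower => a aL [b]; rewrite memv_cap => /andP[bL bH] e.
  apply/(belowP LF); exists a, b; split=> //.
  have -> : a = s v (x v) - b by rewrite e addrK.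
  have := lift_corner (x v); rewrite (mem_corner LV) => /andP[sV _].
  by rewrite rpredB //; apply: subvP (LoHi _ _) _ bL.
case/eqP: nz; apply: layer_below.
by rewrite -[vsval _](subKr (s v (x v))) rpredB //; apply: ls.
Qed.

(** Induction on [i + j]: a lifted layer accounts for a vector of [corner p] up to [below p], whose
    two summands each have a smaller index in one chain. *)
Lemma assemble_surj y : exists t, assemble t == y.
Proof.
suff cover k i j z : (i + j <= k)%N -> (i <= (\dim {:M}).+1)%N ->
    (j <= (\dim {:M}).+1)%N -> z \in lev LF i -> z \in lev LV j ->
    exists t, assemble t == z.
  apply: (cover _ (\dim {:M}).+1 (\dim {:M}).+1 _ (leqnn _));
  by rewrite // lev_full memvf.
elim: k i j z => [|k IH] i j z.
  rewrite leqn0 addn_eq0 => /andP[/eqP-> _] _ _.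
  by rewrite lev0 memv0 => /eqP-> _; exists 0; rewrite linear0.
case: i => [|i] le_k.
  by rewrite lev0 memv0 => _ _ /eqP-> _; exists 0; rewrite linear0.
case: j le_k => [|j] le_k.
  by rewrite lev0 memv0 => _ _ _ /eqP->; exists 0; rewrite linear0.
move=> lt_i lt_j zi zj; pose p : index * index := (Ordinal lt_i, Ordinal lt_j).
have zc : z \in corner p by rewrite (mem_corner LF) zi.
have [t0] : exists t0, z - assemble t0 \in below p.
  have [np|] := boolP (nondeg p); last first.
    rewrite negbK => /subvP sub; exists 0; rewrite linear0 subr0; exact: sub.
  pose v : chain_quiver := Sub p np.
  have zcv : z \in corner (val v) by rewrite SubK.
  exists (dirsum_inj (layer_proj v z : repr_space chain_repr v)).
  have -> : assemble (dirsum_inj (layer_proj v z : repr_space chain_repr v)) =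
      s v (layer_proj v z).
    rewrite /assemble (bigD1 v) //= dirsum_inj_in big1 ?addr0 // => u uv.
    by rewrite dirsum_inj_out ?linear0 // eq_sym.
  have -> : z - s v (layer_proj v z) = (z - vsval (layer_proj v z)) -
      (s v (layer_proj v z) - vsval (layer_proj v z)).
    by rewrite opprB addrA subrK.
  by apply: rpredB; [apply: layer_proj_corner | apply: ls].
case/(belowP LF) => a [b [e aL aH bL bH]].
have [|||||xa /eqP ea] := IH i j.+1 a => //; first by rewrite ltnW.
have [|||||xb /eqP eb] := IH i.+1 j b => //.
- by rewrite addnS in le_k.
- exact: ltnW.
have aD (t t' : T) : assemble (t + t') = assemble t + assemble t'.
  exact: linearD.
exists (t0 + xa + xb); rewrite !aD ea eb -addrA -e.
by rewrite addrC subrK.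
Qed.

Lemma chain_decomposition : module_isomorphic M (attached_module chain_repr).
Proof.
apply: module_isomorphic_sym.
exists (assemble : {linear attached_module chain_repr -> M}); split.
- exists (fun y => xchoose (assemble_surj y)) => [x|y].
    by apply: assemble_inj; apply/eqP; apply: (xchooseP (assemble_surj _)).
  by apply/eqP; apply: (xchooseP (assemble_surj _)).
- exact: (assemble_op LF).
- exact: (assemble_op LV).
Qed.

End Assembly.

End Chains.

Theorem theorem1 (K : fieldType) (sigma tau : {rmorphism K -> K})
    (sigma_aut : bijective sigma) (tau_aut : bijective tau)
    (M : twisted_space sigma tau) (M_GP : gelfand_ponomarev M) :
  (exists (G : quiver) (R : representation sigma tau G),
     kraft_decomposition M R) /\
  (forall (G : quiver) (R : representation sigma tau G)
          (G' : quiver) (R' : representation sigma tau G'),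
     kraft_decomposition M R -> kraft_decomposition M R' ->
     exists f : G -> G', graph_iso f /\ repr_isomorphic_along f R R').
Proof.
split.
  have [s ls s_op] := splitting_exists sigma_aut tau_aut M_GP.
  have sep := @separated_chain_quiver _ _ _ sigma_aut tau_aut _ M_GP.
  exists (chain_quiver sigma_aut tau_aut M_GP).
  exists (chain_repr sigma_aut tau_aut M_GP).
  split; split.
  - exact: kraft_chain_quiver.
  - exact: separated_components.
  - exact: separated_circular.
  - exact: strict_chain_repr.
  - exact: nowhere_zero_chain_repr.
  - exact: chain_decomposition ls s_op.
move=> G R G' R' [[kG nG cG] [sR nzR isoR]] [[kG' nG' cG'] [sR' nzR' isoR']].
apply: attached_module_unique => //; try exact: components_separated.
exact: module_isomorphic_trans (module_isomorphic_sym isoR) isoR'.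
Qed.
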